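(* The optimal resolution pair problem (ORP) is both NP-hard and coNP-hard. Here ORP is: given a CNF formula $F$ and two of its clauses $\gamma$ and $\delta$, decide whether there is a minimum-size regular resolution proof of $F$ that contains the resolution of the leaves $\gamma$ and $\delta$.
   Context: The resolution rule derives from clauses $\alpha \vee x$ and $\beta \vee \neg x$ the resolvent $\alpha \vee \beta$ (resolving on $x$). A resolution proof of a CNF formula $F$ is a directed acyclic graph whose nodes are clauses, whose leaves are clauses of $F$, in which each internal node is the resolvent of its two parents, and whose root is the empty clause. It is regular if no path from the root to a leaf contains two resolution steps on the same variable. The size of a proof is its number of clauses (nodes). *)

(* Defs.v *)
From HB Require Import structures.
From mathcomp Require Import all_boot.
From mathcomp Require Import finmap.

Set Implicit Arguments.
Unset Strict Implicit.
Unset Printing Implicit Defensive.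

Local Open Scope fset_scope.

(* A literal is a variable (nat) with a polarity (true = positive x,
   false = negative ~x).  A clause is a finite set of literals. *)
Definition literal := (nat * bool)%type.
Definition clause := {fset literal}.

(* A resolution proof is a DAG given as a list of nodes in topological
   order: a node is either a leaf labelled by a clause, or a resolution
   step [PRes i j x C] with earlier parents i (containing x) and j
   (containing ~x), resolving on variable x, with resolvent C. *)
Inductive pnode :=
| PLeaf of clause
| PRes of nat & nat & nat & clause.

Definition pdefault : pnode := PLeaf fset0.

Definition node_label (nd : pnode) : clause :=
  match nd with PLeaf C => C | PRes _ _ _ C => C end.

Definition plabel (P : seq pnode) (i : nat) : clause :=
  node_label (nth pdefault P i).

Definition resolvent (C1 C2 : clause) (x : nat) : clause :=
  (C1 `\ (x, true)) `|` (C2 `\ (x, false)).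

Definition valid_node (F : seq clause) (P : seq pnode) (k : nat) : Prop :=
  match nth pdefault P k with
  | PLeaf C => C \in F
  | PRes i j x C =>
      [/\ i < k, j < k, (x, true) \in plabel P i, (x, false) \in plabel P j
        & C = resolvent (plabel P i) (plabel P j) x]
  end.

Definition is_parent (P : seq pnode) (k m : nat) : bool :=
  match nth pdefault P k with
  | PRes i j _ _ => (m == i) || (m == j)
  | PLeaf _ => false
  end.

Definition is_leaf (P : seq pnode) (k : nat) : bool :=
  if nth pdefault P k is PLeaf _ then true else false.

Definition root (P : seq pnode) : nat := (size P).-1.

Definition is_res_proof (F : seq clause) (P : seq pnode) : Prop :=
  [/\ 0 < size P,
      (forall k, k < size P -> valid_node F P k),
      plabel P (root P) = fset0
    & (forall k, k < root P -> exists2 m, m < size P & is_parent P m k)].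

Definition res_var (P : seq pnode) (k : nat) : option nat :=
  if nth pdefault P k is PRes _ _ x _ then Some x else None.

Definition regular (P : seq pnode) : Prop :=
  forall s : seq nat,
    path (is_parent P) (root P) s ->
    is_leaf P (last (root P) s) ->
    uniq (pmap (res_var P) (root P :: s)).

Definition proof_size (P : seq pnode) : nat := size P.

Definition contains_res_of_leaves (P : seq pnode) (g d : clause) : Prop :=
  exists k i j x C,
    [/\ k < size P, nth pdefault P k = PRes i j x C &
        (nth pdefault P i = PLeaf g /\ nth pdefault P j = PLeaf d) \/
        (nth pdefault P i = PLeaf d /\ nth pdefault P j = PLeaf g)].

Definition ORP_instance (F : seq clause) (g d : clause) : Prop :=
  [/\ g \in F, d \in F &
      exists P, [/\ is_res_proof F P, regular P,
        (forall Q, is_res_proof F Q -> regular Q ->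
           proof_size P <= proof_size Q)
      & contains_res_of_leaves P g d]].

(* little-endian binary digits of n (no trailing zeros) *)
Fixpoint bits_aux (fuel n : nat) : seq bool :=
  match fuel with
  | 0 => [::]
  | f.+1 => if n == 0 then [::] else odd n :: bits_aux f n./2
  end.
Definition bits (n : nat) : seq bool := bits_aux n n.

(* 3-bit codes for a 6-letter alphabet *)
Definition sym0 := [:: false; false; false].
Definition sym1 := [:: false; false; true].
Definition symPos := [:: false; true; false]. (* end of positive literal *)
Definition symNeg := [:: false; true; true].  (* end of negative literal *)
Definition symEndC := [:: true; false; false].
Definition symEndF := [:: true; false; true].

Definition enc_lit (l : literal) : seq bool :=
  flatten [seq (if b then sym1 else sym0) | b <- bits l.1]
  ++ (if l.2 then symPos else symNeg).

Definition enc_clause (c : seq literal) : seq bool :=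
  flatten (map enc_lit c) ++ symEndC.

Definition enc_instance (Fs : seq (seq literal)) (gs ds : seq literal)
  : seq bool :=
  flatten (map enc_clause Fs) ++ symEndF ++ enc_clause gs ++ enc_clause ds.

Definition clause_of (c : seq literal) : clause := seq_fset tt c.

Definition ORP_lang (w : seq bool) : Prop :=
  exists Fs gs ds, w = enc_instance Fs gs ds /\
    ORP_instance (map clause_of Fs) (clause_of gs) (clause_of ds).

Inductive move := MLeft | MRight | MStay.

(* deterministic single-tape Turing machine, two-way infinite tape *)
Record TM := {
  tm_state : finType;
  tm_sym : finType;
  tm_blank : tm_sym;
  tm_in : bool -> tm_sym;
  tm_out : tm_sym -> option bool;
  tm_start : tm_state;
  tm_halt : pred tm_state;
  tm_accept : pred tm_state;
  tm_delta : tm_state -> tm_sym -> tm_state * tm_sym * move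
}.

Arguments tm_blank : clear implicits.
Arguments tm_in : clear implicits.
Arguments tm_out : clear implicits.
Arguments tm_start : clear implicits.
Arguments tm_halt : clear implicits.
Arguments tm_accept : clear implicits.
Arguments tm_delta : clear implicits.

(* configuration: state, left tape (reversed), head symbol, right tape *)
Definition config (M : TM) := (tm_state M * seq (tm_sym M) * tm_sym M
                               * seq (tm_sym M))%type.

Definition init_config (M : TM) (w : seq bool) : config M :=
  match map (tm_in M) w with
  | [::] => (tm_start M, [::], tm_blank M, [::])
  | a :: r => (tm_start M, [::], a, r)
  end.

Definition tm_step (M : TM) (c : config M) : config M :=
  let: (q, l, h, r) := c in
  if tm_halt M q then c else
  let: (q', s, m) := tm_delta M q h in
  match m with
  | MStay => (q', l, s, r)
  | MLeft => match l with
             | [::] => (q', [::], tm_blank M, s :: r)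
             | a :: l' => (q', l', a, s :: r)
             end
  | MRight => match r with
              | [::] => (q', s :: l, tm_blank M, [::])
              | a :: r' => (q', s :: l, a, r')
              end
  end.

Definition tm_run (M : TM) (w : seq bool) (n : nat) : config M :=
  iter n (@tm_step M) (@init_config M w).

Definition cstate (M : TM) (c : config M) : tm_state M :=
  let: (q, _, _, _) := c in q.

Fixpoint read_out (M : TM) (s : seq (tm_sym M)) : seq bool :=
  match s with
  | [::] => [::]
  | a :: s' => match tm_out M a with
               | Some b => b :: @read_out M s'
               | None => [::]
               end
  end.

Definition coutput (M : TM) (c : config M) : seq bool :=
  let: (_, _, h, r) := c in @read_out M (h :: r).

Definition poly_bound (c n : nat) : nat := c * n ^ c + c.

Definition poly_time_computable (f : seq bool -> seq bool) : Prop :=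
  exists (M : TM) (c : nat), forall w, exists2 n, n <= poly_bound c (size w) &
    tm_halt M (cstate (tm_run M w n)) /\ coutput (tm_run M w n) = f w.

Definition in_P (L : seq bool -> Prop) : Prop :=
  exists (M : TM) (c : nat), forall w, exists2 n, n <= poly_bound c (size w) &
    tm_halt M (cstate (tm_run M w n)) /\
    (tm_accept M (cstate (tm_run M w n)) <-> L w).

Definition pair_enc (w y : seq bool) : seq bool :=
  flatten [seq [:: b; b] | b <- w] ++ [:: false; true] ++ y.

Definition in_NP (L : seq bool -> Prop) : Prop :=
  exists (V : seq bool -> Prop) (c : nat), in_P V /\
    forall w, L w <-> exists2 y, size y <= poly_bound c (size w) & V (pair_enc w y).

Definition poly_reduces (L1 L2 : seq bool -> Prop) : Prop :=
  exists2 f, poly_time_computable f & forall w, L1 w <-> L2 (f w).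

Definition NP_hard (L : seq bool -> Prop) : Prop :=
  forall L', in_NP L' -> poly_reduces L' L.

Definition coNP_hard (L : seq bool -> Prop) : Prop :=
  forall L', in_NP L' -> poly_reduces (fun w => ~ L' w) L.

(* Main.v *)
From mathcomp Require Import all_boot finmap zify.
Require Import Defs.

Set Implicit Arguments.
Unset Strict Implicit.
Unset Printing Implicit Defensive.

(**
  A refutation whose leaves are k nodes has at
  least 2k - 1 nodes, since every node but the root has a child, and a read-once
  linear input refutation attains the bound.  Given goals j, each served by some
  choices "contents g in cell c", take the clauses ~G \/ \/_j ~S_j, the unit G,
  S_j \/ ~A_(c,g) whenever (c,g) serves j, and the units A_(c,g).  If every cell
  has a goal served only by that cell, the leaves of a refutation contain the
  first clause, G, a clause for every j, and a unit for every cell; merging of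
  literals lets one unit serve many goals, so this number of leaves suffices iff
  one choice of contents per cell serves all the goals.  A disjoint decoy
  ~Y_1 \/ ... \/ ~Y_m, Y_1, ..., Y_m has refutations of known minimal size, and
  m can be tuned so that the decoy is optimal or not according to that
  alternative.  Asking for the resolution of G with the first clause gives
  NP-hardness, asking for the one of Y_1 with the decoy gives coNP-hardness.

  Accepting tableaux of a Turing machine (Cook-Levin) are such choices: a goal per cell
  (some admissible content) and a goal per 2x2 block and forbidden window (some
  corner differs from it).  The reduction is computed by nested loops over the
  cells of a region of the tape, with pebbles as loop counters; they are run by a
  machine that sweeps its tape with a Mealy machine and appends a symbol at the
  end of each sweep.
*)

(** * Sweeping machines *)

Section Sweeper.
Variables (Q S : finType) (delta : Q -> S -> Q * S) (fin : Q -> Q * option S).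
Variables (q0 : Q) (done : pred Q) (inp : bool -> S) (out : S -> option bool).

Fixpoint sweep (q : Q) (x : seq S) : Q * seq S :=
  if x is a :: r then
    let: (q1, b) := delta q a in let: (q2, r') := sweep q1 r in (q2, b :: r')
  else (q, [::]).

Definition macro (c : Q * seq S) : Q * seq S :=
  let: (q, x) := sweep c.1 c.2 in let: (q', o) := fin q in (q', x ++ seq_of_opt o).

(* [inl (inl q)] walks left, [inl (inr q)] sweeps right, [inr false] looks for
   the first output symbol and [inr true] is the halting state. The used part of
   the tape is delimited by blanks on both sides. *)
Definition sweeper_state : finType := (Q + Q + bool)%type.

Definition sweeper_delta (s : sweeper_state) (a : option S) :
    sweeper_state * option S * move :=
  match s, a with
  | inl (inl q), Some a => (inl (inl q), Some a, MLeft)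
  | inl (inl q), None => (if done q then inr false else inl (inr q), None, MRight)
  | inl (inr q), Some a => let: (q', b) := delta q a in (inl (inr q'), Some b, MRight)
  | inl (inr q), None => let: (q', o) := fin q in (inl (inl q'), o, MLeft)
  | inr b, Some a => if out a then (inr true, Some a, MStay) else (inr b, Some a, MRight)
  | inr b, None => (inr true, None, MStay)
  end.

Definition sweeper : TM :=
  {| tm_state := sweeper_state; tm_sym := option S; tm_blank := None;
     tm_in := fun b => Some (inp b); tm_out := obind out;
     tm_start := inl (inl q0); tm_halt := pred1 (inr true);
     tm_accept := pred0; tm_delta := sweeper_delta |}.

Let step := @tm_step sweeper.

(** The head rests on the blank to the left of the used tape. Blanks visited earlier on the right
    stay in the list, hence the count [k], which is existentially quantified in the results of a
    run. *)
Definition resting (q : Q) (x : seq S) (k : nat) : config sweeper :=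
  (inl (inl q) : tm_state sweeper, [::], None, map Some x ++ nseq k None).

(** The extra step reads the first blank after [x]: it writes the optional symbol of [fin] there and
    turns back, so that appending is part of the sweep. *)
Lemma sweep_right (q : Q) x l k :
  exists k',
  iter (size x).+1 step
    (inl (inr q) : tm_state sweeper, l, head None (map Some x ++ nseq k None),
     behead (map Some x ++ nseq k None)) =
  (let: (q', x') := sweep q x in let: (q'', o) := fin q' in
   let l' := rev (map Some x') ++ l in
   (inl (inl q''), behead l', head None l', o :: nseq k' None)).
Proof.
elim: x q l => [|a x IH] q l.
  exists k.-1; rewrite /step /tm_step /=.
  have -> : head None (nseq k (@None S)) = None by case: k.
  rewrite /=; case: (fin q) => q' o.
  have -> : behead (nseq k (@None S)) = nseq k.-1 None by case: k.
  by case: l.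
rewrite [size _]/= iterSr.
case E: (delta q a) => [q1 b].
have [k' H] := IH q1 (Some b :: l); exists k'.
set c := step _; set c' := (X in iter _ _ X = _) in H.
have -> : c = c'.
  by rewrite /c /c' /step /tm_step /= E; case: (_ ++ _).
rewrite H /= E; case: (sweep q1 x) => q2 x'; case: (fin q2) => q3 o.
by rewrite /= rev_cons cat_rcons.
Qed.

Lemma walk_left (q : Q) x r :
  iter (size x) step
    (inl (inl q) : tm_state sweeper, behead (rev (map Some x) ++ [:: None]),
       head None (rev (map Some x) ++ [:: None]), r) =
    (inl (inl q) : tm_state sweeper, [::], None, map Some x ++ r).
Proof.
elim/last_ind: x r => [|x b IH] r //.
rewrite size_rcons iterSr map_rcons rev_rcons /=.
rewrite -cats1 -catA /= -(IH (Some b :: r)); congr iter.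
by rewrite /step /tm_step /=; case: (rev _) => [|? ?].
Qed.

Lemma sweep_size q x : size (sweep q x).2 = size x.
Proof.
elim: x q => //= a x IH q; case: (delta q a) => q1 b.
by have := IH q1; case: (sweep q1 x) => q2 r /= ->.
Qed.

(** The count is one step off the left blank, [(size x).+1] steps to the right and [size x] steps
    back. *)
Lemma sweeper_macro q x k : ~~ done q ->
  exists k', iter ((size x).*2 + 2) step (resting q x k) =
             resting (macro (q, x)).1 (macro (q, x)).2 k'.
Proof.
move=> /negPf nd; have [k' H] := sweep_right q x [:: None] k.
have sz := sweep_size q x.
rewrite /macro; case E: (sweep q x) H sz => [q' x'] H; rewrite [_.2]/= => sz.

case F: (fin q') H => [q'' o] H.
(* If nothing is appended, the blank read at the end of the sweep joins the trailing blanks. *)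
exists (if o is None then k'.+1 else k').
have -> : (size x).*2 + 2 = size x' + (size x).+2 by rewrite sz; lia.
rewrite iterD iterSr.
set c := step _; set c' := (X in iter _ _ X = _) in H.
have -> : c = c'.
  by rewrite /c /c' /step /tm_step /= nd; case: (_ ++ _).
rewrite H /= walk_left // /resting; congr (_, _, _, _).
by case: (o) => [b|] /=; rewrite ?cats0 // map_cat -catA.
Qed.

(** [coutput] reads from the head to the right, so the machine halts on the first symbol that stands
    for an output bit. *)
Lemma read_out_skip (x : seq S) k l :
  exists2 n, n <= (size x).+1 &
  let c := iter n step (inr false : tm_state sweeper, l,
       head None (map Some x ++ nseq k None), behead (map Some x ++ nseq k None)) in
  cstate c = inr true /\
  coutput c = @read_out sweeper (map Some (drop (find out x) x)).
Proof.
have read_blank j y : @read_out sweeper (map Some y ++ nseq j None) =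
                      @read_out sweeper (map Some y).
  by elim: y => [|a y IH] /=; [case: j | rewrite IH].
elim: x l => [|a x IH] l.
  exists 1 => //; split; first by case: k.
  by case: k.
case E: (out a) => [b|].
  exists 1 => //; split; first by rewrite /= /step /tm_step /= E.
  by rewrite /step /tm_step /= E /= E /= read_blank.
have [n le_n [H1 H2]] := IH (Some a :: l).
exists n.+1 => //; rewrite iterSr.
set c := step _.
have -> : c = (inr false : tm_state sweeper, Some a :: l,
       head None (map Some x ++ nseq k None), behead (map Some x ++ nseq k None)).
  by rewrite /c /step /tm_step /= E; case: (_ ++ _).
by rewrite /= E.
Qed.

Lemma iter_macro n q x k :
  (forall m, m < n -> ~~ done (iter m macro (q, x)).1) ->
  exists2 N, N <= n * ((size x + n).*2 + 2) &
  exists k', iter N step (resting q x k) =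
     resting (iter n macro (q, x)).1 (iter n macro (q, x)).2 k'.
Proof.
elim: n q x k => [|n IH] q x k H; first by exists 0 => //; exists k.
have [k1 H1] := sweeper_macro x k (H 0 isT).
have sz : size (macro (q, x)).2 <= (size x).+1.
  rewrite /macro /=; have := sweep_size q x; case: (sweep q x) => q1 x1 /= <-.
  by case: (fin q1) => q2 [b|] /=; rewrite size_cat /=; lia.
have [|N leN [k2 H2]] := IH (macro (q, x)).1 (macro (q, x)).2 k1.
  move=> m lt_m; have := H m.+1 lt_m; rewrite iterSr.
  by case: (macro (q, x)).
exists (N + ((size x).*2 + 2)).
  have : n * ((size (macro (q, x)).2 + n).*2 + 2) <= n * ((size x + n.+1).*2 + 2).
    by apply: leq_mul => //; lia.
  by rewrite mulSn; lia.
exists k2; rewrite iterD H1 H2 iterSr.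
by case: (macro (q, x)).
Qed.

(** Each sweep lengthens the tape by at most one symbol, so [n] sweeps cost a number of steps
    quadratic in [size w + n]. *)
Theorem sweeper_correct (w : seq bool) n q x :
  iter n macro (q0, map inp w) = (q, x) -> done q ->
  (forall m, m < n -> ~~ done (iter m macro (q0, map inp w)).1) ->
  exists2 N, N <= (n.+1) * ((size w + n).*2 + 4) + 2 &
    tm_halt sweeper (cstate (tm_run sweeper w N)) /\
    coutput (tm_run sweeper w N) =
      @read_out sweeper (map Some (drop (find out x) x)).
Proof.
move=> E dq H.
have szx m : size (iter m macro (q0, map inp w)).2 <= size w + m.
  elim: m => [|m IH]; first by rewrite /= size_map addn0.
  rewrite iterS; case: (iter m _ _) IH => [q1 x1] /= IH.
  rewrite /macro /=; have := sweep_size q1 x1; case: (sweep q1 x1) => q2 x2 /= E2.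
  by case: (fin q2) => q3 [b|] /=; rewrite size_cat /=; lia.
have [N1 leN1 [k H1]] := iter_macro 0 H.
rewrite E /= in H1.
have [N2 leN2 [H2 H3]] := read_out_skip x k [:: None].
have [k0 H0] : exists2 k0, k0 <= 1 &
    iter k0 step (init_config sweeper w) = resting q0 (map inp w) 0.
  rewrite /init_config /resting; case: w {E H szx leN1 H1} => [|b w] /=.
    by exists 0.
  exists 1 => //=; rewrite /step /tm_step /= cats0 -!map_comp //.
move=> Hk0.
have szx' := szx n; rewrite E /= in szx'.
have R : iter (N2.+1 + N1 + k0) step (init_config sweeper w) =
   iter N2 step (inr false : tm_state sweeper, [:: None],
       head None (map Some x ++ nseq k None), behead (map Some x ++ nseq k None)).
  rewrite iterD Hk0 iterD H1 iterSr; congr iter.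
  by rewrite /resting /step /tm_step /= dq; case: (_ ++ _).
exists (N2.+1 + N1 + k0).
  by rewrite size_map in leN1; nia.
by rewrite /tm_run R H3 H2 /=.
Qed.

End Sweeper.

(** * Polynomial bounds *)

(** The base is at least 2, so that raising the exponent absorbs constants and sums even at
    [n = 0]. *)
Definition polyb (f : nat -> nat) := exists k, forall n, f n <= (n + 2) ^ k.

Lemma polyb_le f g : (forall n, f n <= g n) -> polyb g -> polyb f.
Proof. by move=> le [k H]; exists k => n; exact: leq_trans (le n) (H n). Qed.

Lemma polyb_const c : polyb (fun=> c).
Proof.
exists c => n; apply: leq_trans (ltnW (ltn_expl c (isT : 1 < 2))) _.
by case: c => // c; rewrite leq_exp2r //; lia.
Qed.

Lemma polyb_id : polyb id.
Proof. by exists 1 => n; rewrite expn1; lia. Qed.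

Lemma polyb_add f g : polyb f -> polyb g -> polyb (fun n => f n + g n).
Proof.
move=> [k H] [l L]; exists (maxn k l).+1 => n.
have h : (n + 2) ^ k <= (n + 2) ^ maxn k l by rewrite leq_exp2l; lia.
have h' : (n + 2) ^ l <= (n + 2) ^ maxn k l by rewrite leq_exp2l; lia.
by rewrite expnS; have := H n; have := L n; nia.
Qed.

Lemma polyb_mul f g : polyb f -> polyb g -> polyb (fun n => f n * g n).
Proof. by move=> [k H] [l L]; exists (k + l) => n; rewrite expnD leq_mul. Qed.

Lemma polyb_succ f : polyb f -> polyb (fun n => (f n).+1).
Proof.
move=> H; apply: (@polyb_le _ (fun n => f n + 1)) => [n|]; first by lia.
by apply: polyb_add => //; exact: polyb_const.
Qed.

Lemma polyb_comp f g : polyb f -> polyb g -> polyb (fun n => f (g n)).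
Proof.
move=> [k H] [l L]; exists (l.+2 * k) => n; apply: leq_trans (H _) _.
rewrite expnM; case: k {H} => // k; rewrite leq_exp2r //.
have := L n; have : 0 < (n + 2) ^ l by rewrite expn_gt0; lia.
by rewrite !expnS; nia.
Qed.

(** The constant [3 ^ k] serves as summand for [n = 0], and as factor and exponent for [n > 0],
    where [n + 2 <= 3 * n]. *)
Lemma polyb_bound f : polyb f -> exists c, forall n, f n <= poly_bound c n.
Proof.
move=> [k H]; exists (3 ^ k) => n; apply: leq_trans (H n) _; rewrite /poly_bound.
case: n => [|n].
  apply: leq_trans (leq_addl _ _); rewrite add0n.
  by case: k {H} => // k; rewrite leq_exp2r.
apply: leq_trans (leq_addr _ _).
apply: (@leq_trans ((3 * n.+1) ^ k)).
  by case: k {H} => // k; rewrite leq_exp2r //; lia.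
rewrite expnMn leq_mul // leq_pexp2l //.
exact: ltnW (ltn_expl _ _).
Qed.

Lemma polyb_poly_bound c : polyb (poly_bound c).
Proof.
apply: polyb_add; last exact: polyb_const.
apply: polyb_mul; first exact: polyb_const.
by exists c => n; case: c => // c; rewrite leq_exp2r //; lia.
Qed.

(** * Pebble loop programs *)

Section Prog.
Variables (D : finType) (K : nat).

Definition cell : finType := (D * {ffun 'I_K -> bool})%type.

(* A test holds if some cell satisfies it together with its left neighbour. *)
Inductive prog :=
| Skip
| Emit of D
| Seq of prog & prog
| If of (option cell -> cell -> bool) & prog & prog
| For of 'I_K & prog.

Definition env := 'I_K -> option nat.
Definition env0 : env := fun=> None.
Definition upd (e : env) (p : 'I_K) (v : option nat) : env :=
  fun q => if q == p then v else e q.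

Fixpoint cells (k : nat) (x : seq D) (e : env) : seq cell :=
  if x is d :: r then (d, [ffun p => e p == Some k]) :: cells k.+1 r e else [::].

Fixpoint holds (prev : option cell) (r : option cell -> cell -> bool)
    (cs : seq cell) : bool :=
  if cs is c :: cs' then r prev c || holds (Some c) r cs' else false.

Fixpoint eval (x : seq D) (c : prog) (e : env) : seq D :=
  match c with
  | Skip => [::]
  | Emit d => [:: d]
  | Seq a b => eval x a e ++ eval x b e
  | If r a b => if holds None r (cells 0 x e) then eval x a e else eval x b e
  | For p a => flatten [seq eval x a (upd e p (Some i)) | i <- iota 0 (size x)]
  end.

Fixpoint wf (A : seq 'I_K) (c : prog) : bool :=
  match c with
  | Seq a b | If _ a b => wf A a && wf A b
  | For p a => (p \notin A) && wf (p :: A) a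
  | _ => true
  end.

(** Bounds both the length of the output and the number of sweeps of the compiled code: a
    conditional adds a test and a jump, a loop adds one placement and one advance per round. *)
Fixpoint cost (n : nat) (c : prog) : nat :=
  match c with
  | Skip => 0
  | Emit _ => 1
  | Seq a b => cost n a + cost n b
  | If _ a b => 2 + cost n a + cost n b
  | For _ a => 1 + n * (cost n a).+1
  end.

Lemma size_eval x c e : size (eval x c e) <= cost (size x) c.
Proof.
elim: c e => //= [a IHa b IHb|r a IHa b IHb|p a IH] e.
- by rewrite size_cat leq_add.
- by case: ifP => _; [have := IHa e|have := IHb e]; lia.
- rewrite size_flatten /shape -map_comp sumnE big_map.
  apply: leq_trans (_ : \sum_(j <- iota 0 (size x)) (cost (size x) a).+1 <= _).
    by apply: leq_sum => i _; apply: leq_trans (IH _) _.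
  by rewrite big_const_seq count_predT size_iota iter_addn; lia.
Qed.

(* [IConv] turns the region into dead cells and the output into a new region; the
   natural numbers are jump targets. *)
Inductive instr :=
| IEmit of D
| IPlace of 'I_K & nat
| IAdv of 'I_K & nat
| ITest of (option cell -> cell -> bool) & nat
| IJmp of nat
| IConv.

Definition aux : finType := (option cell * bool)%type.
Definition aux0 : aux := (None, false).

Definition tape_sym : finType := (cell + D + unit)%type.
Definition SCell (c : cell) : tape_sym := inl (inl c).
Definition SEm (d : D) : tape_sym := inl (inr d).
Definition SJunk : tape_sym := inr tt.

Definition setp (p : 'I_K) (v : bool) (c : cell) : cell :=
  (c.1, [ffun q => if q == p then v else c.2 q]).

(** The flag [a.2] means for [IPlace] that the pebble has been placed, for [IAdv] that it has been
    picked up and awaits the next cell, and for [ITest] that the test has succeeded. Only tests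
    remember the left neighbour in [a.1]. *)
Definition istep (I : instr) (a : aux) (c : cell) : aux * cell :=
  match I with
  | IPlace p _ => if a.2 then (a, c) else ((None, true), setp p true c)
  | IAdv p _ => if a.2 then ((None, false), setp p true c)
                else if c.2 p then ((None, true), setp p false c) else (a, c)
  | ITest r _ => ((Some c, a.2 || r a.1 c), c)
  | _ => (a, c)
  end.

Definition sstep (I : instr) (a : aux) (s : tape_sym) : aux * tape_sym :=
  match s with
  | inl (inl c) => if I is IConv then (a, SJunk)
                   else let: (a', c') := istep I a c in (a', SCell c')
  | inl (inr d) => if I is IConv then (a, SCell (d, [ffun=> false])) else (a, s)
  | inr _ => (a, s)
  end.

(** The flag at the end of the sweep decides uniformly: it is down for [IPlace] on an empty region,
    which skips the loop; it is up for [IAdv] when the pebble fell off the right end, which leaves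
    the loop; [IJmp] never raises it. *)
Definition inext (I : instr) (a : aux) (pc : nat) : nat :=
  match I with
  | IPlace _ t | IAdv _ t | ITest _ t | IJmp t => if a.2 then pc.+1 else t
  | _ => pc.+1
  end.

Definition iemit (I : instr) : option tape_sym :=
  if I is IEmit d then Some (SEm d) else None.

Fixpoint isweep (I : instr) (a : aux) (cs : seq cell) : aux * seq cell :=
  if cs is c :: cs' then
    let: (a1, c1) := istep I a c in let: (a2, cs2) := isweep I a1 cs' in
    (a2, c1 :: cs2)
  else (a, [::]).

Fixpoint clen (c : prog) : nat :=
  match c with
  | Skip => 0
  | Emit _ => 1
  | Seq a b => clen a + clen b
  | If _ a b => 2 + clen a + clen b
  | For _ a => 2 + clen a
  end.

Fixpoint compile (o : nat) (c : prog) : seq instr :=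
  match c with
  | Skip => [::]
  | Emit d => [:: IEmit d]
  | Seq a b => compile o a ++ compile (o + clen a) b
  | If r a b => ITest r (o + clen a + 2) :: compile o.+1 a ++
                IJmp (o + clen a + clen b + 2) :: compile (o + clen a + 2) b
  | For p a => IPlace p (o + clen a + 2) :: compile o.+1 a ++ [:: IAdv p o.+1]
  end.

Lemma size_compile o c : size (compile o c) = clen c.
Proof.
elim: c o => //= [a IHa b IHb|r a IHa b IHb|p a IH] o;
  by rewrite size_cat /= ?IHa ?IHb ?IH; lia.
Qed.

(* [tape j cs o]: dead cells of an earlier region, the current region, the output. *)
Definition tape (j : nat) (cs : seq cell) (o : seq D) : seq tape_sym :=
  nseq j SJunk ++ map SCell cs ++ map SEm o.

(** * Correctness of the compiled code *)

Section Exec.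
Variable code : seq instr.

Definition ctl : finType := ('I_(size code).+1 * aux)%type.
Definition cur (pc : nat) := nth IConv code pc.
Definition ctl_delta (q : ctl) (s : tape_sym) : ctl * tape_sym :=
  let: (a, s') := sstep (cur q.1) q.2 s in ((q.1, a), s').
Definition ctl_fin (q : ctl) : ctl * option tape_sym :=
  ((inord (inext (cur q.1) q.2 q.1), aux0), iemit (cur q.1)).
Definition at_pc (pc : nat) : ctl := (inord pc, aux0).
Definition ctl_done : pred ctl := fun q => q.1 == size code :> nat.

Notation step := (macro ctl_delta ctl_fin).

Lemma sweep_em pc a o : (if cur pc is IConv then False else True) -> pc < size code ->
  sweep ctl_delta (inord pc : 'I_(size code).+1, a) (map SEm o) =
  ((inord pc, a), map SEm o).
Proof.
move=> nc lt; elim: o => //= d o IH.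
rewrite /ctl_delta /= inordK; last by lia.
by case: (cur pc) nc => //= *; rewrite IH.
Qed.

Lemma sweep_tape pc a j cs o : (if cur pc is IConv then False else True) ->
  pc < size code ->
  sweep ctl_delta (inord pc : 'I_(size code).+1, a) (tape j cs o) =
  let: (a', cs') := isweep (cur pc) a cs in ((inord pc, a'), tape j cs' o).
Proof.
move=> nc lt; elim: j => [|j IH] /=; last first.
  by rewrite -/(tape j cs o) IH; case: (isweep _ _ _).
rewrite /tape /=; elim: cs a => [|c cs IH] a /=; first exact: sweep_em.
rewrite {1}/ctl_delta /= inordK; last by lia.
have -> : (if cur pc is IConv then (a, SJunk) else
   let: (a', c') := istep (cur pc) a c in (a', SCell c')) =
   let: (a', c') := istep (cur pc) a c in (a', SCell c').
  by case: (cur pc) nc.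
case: (istep _ _ _) => a1 c1 /=.
by rewrite IH; case: (isweep _ _ _).
Qed.

Lemma step_tape pc j cs o : (if cur pc is IConv then False else True) ->
  pc < size code ->
  step (at_pc pc, tape j cs o) =
  let: (a', cs') := isweep (cur pc) aux0 cs in
  (at_pc (inext (cur pc) a' pc),
   tape j cs' (if cur pc is IEmit d then rcons o d else o)).
Proof.
move=> nc lt; rewrite /macro sweep_tape //.
case: (isweep _ _ _) => a' cs'; rewrite /ctl_fin /= inordK; last by lia.
rewrite /at_pc; congr pair.
case: (cur pc) nc => //= *; rewrite ?cats0 //.
by rewrite /tape map_rcons -cats1 -!catA.
Qed.

Lemma step_conv pc cs o : cur pc = IConv -> pc < size code ->
  step (at_pc pc, tape 0 cs o) =
  (at_pc pc.+1, tape (size cs) (cells 0 o env0) [::]).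
Proof.
move=> nc lt; rewrite /macro.
have -> : sweep ctl_delta (at_pc pc) (tape 0 cs o) =
          (at_pc pc, tape (size cs) (cells 0 o env0) [::]).
  rewrite /tape cats0; elim: cs => [|c cs IH] /=; last first.
    rewrite {1}/ctl_delta /= inordK; last by lia.
    by rewrite nc /= IH.
  move: 0; elim: o => //= d o IH k.
  rewrite {1}/ctl_delta /= inordK; last by lia.
  rewrite nc /= (IH k.+1) /SCell.
  by congr (_, inl (inl (d, _)) :: _); apply/ffunP=> q; rewrite !ffunE.
by rewrite /ctl_fin /= inordK ?nc /= ?cats0 //; lia.
Qed.

(** That no earlier state is final is recorded because [sweeper_correct] asks for it. *)
Definition reach (n : nat) s s' := exists2 k, k <= n & iter k step s = s' /\
  forall m, m < k -> ~~ ctl_done (iter m step s).1.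

Lemma reach0 s : reach 0 s s. Proof. by exists 0. Qed.

Lemma reach_trans n1 n2 s1 s2 s3 :
  reach n1 s1 s2 -> reach n2 s2 s3 -> reach (n1 + n2) s1 s3.
Proof.
move=> [k1 le1 [E1 H1]] [k2 le2 [E2 H2]].
exists (k2 + k1); first lia.
split; first by rewrite iterD E1.
move=> m lt_m; case: (ltnP m k1) => [/H1 //|le].
rewrite -(subnK le) iterD E1; apply: H2; lia.
Qed.

Lemma reach_le n1 n2 s s' : n1 <= n2 -> reach n1 s s' -> reach n2 s s'.
Proof. by move=> le [k lek H]; exists k => //; lia. Qed.

Lemma reach1 pc j cs o : (if cur pc is IConv then False else True) ->
  pc < size code ->
  reach 1 (at_pc pc, tape j cs o) 
  (let: (a', cs') := isweep (cur pc) aux0 cs in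
  (at_pc (inext (cur pc) a' pc),
   tape j cs' (if cur pc is IEmit d then rcons o d else o))).
Proof.
move=> nc lt; exists 1 => //; split; first exact: step_tape.
move=> [|] // _; rewrite /ctl_done /= inordK; lia.
Qed.

Lemma isweep_id I cs : (match I with IEmit _ | IJmp _ => true | _ => false end) ->
  isweep I aux0 cs = (aux0, cs).
Proof. by case: I => //= z _; elim: cs => //= c cs ->. Qed.

Lemma isweep_test r t cs a :
  exists p, isweep (ITest r t) a cs = ((p, a.2 || holds a.1 r cs), cs).
Proof.
elim: cs a => [|c cs IH] a /=; first by exists a.1; case: a => ? []. 
by have [p ->] := IH (Some c, a.2 || r a.1 c); exists p; rewrite /= orbA.
Qed.

Lemma cells_eq k x e e' : (forall q i, k <= i -> (e q == Some i) = (e' q == Some i)) ->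
  cells k x e = cells k x e'.
Proof.
elim: x k => //= d x IH k H; congr (_ :: _); last by apply: IH => q i ?; apply: H; lia.
by congr pair; apply/ffunP=> q; rewrite !ffunE H.
Qed.

Lemma isweep_place p t k x e : e p = None ->
  isweep (IPlace p t) aux0 (cells k x e) =
  ((None, x != [::]), cells k x (upd e p (Some k))).
Proof.
move=> ep; case: x => //= d x.
have -> y : isweep (IPlace p t) (None, true) y = ((None, true), y).
  by elim: y => //= c y ->.
congr (_, _ :: _).
  rewrite /setp; congr pair; apply/ffunP=> q; rewrite !ffunE /upd.
  by case: (q == p); rewrite ?eqxx.
apply: cells_eq => q i lt; rewrite /upd.
by case: (_ =P p) => // ->; rewrite ep; apply/esym/eqP; case; lia.
Qed.

(** Once the pebble has been dropped, the rest of the sweep is inert: the flag is down and no cell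
    further right carries [p]. *)
Lemma isweep_adv_done p t k x e i : e p = Some i -> i < k ->
  isweep (IAdv p t) aux0 (cells k x e) = (aux0, cells k x e).
Proof.
move=> ep; elim: x k => //= d x IH k lt.
have -> : [ffun p0 => e p0 == Some k] p = false.
  by rewrite ffunE ep; apply/eqP; case; lia.
by rewrite IH //; lia.
Qed.

Lemma isweep_adv p t k x e i : e p = Some (k + i) -> i < size x ->
  isweep (IAdv p t) aux0 (cells k x e) =
  ((None, i.+1 == size x),
   cells k x (upd e p (if i.+1 == size x then None else Some (k + i).+1))).
Proof.
elim: x k i => //= d x IH k [|i] ep lt.
  rewrite ffunE ep addn0 eqxx.
  have e1 v : v != Some k -> setp p false (d, [ffun p0 => e p0 == Some k]) =
     (d, [ffun p0 => upd e p v p0 == Some k]).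
    move=> nv; rewrite /setp; congr pair; apply/ffunP=> q; rewrite !ffunE /upd.
    by case: (_ =P p) => // _; rewrite (negPf nv).
  case: x IH lt => /= [|d' x] IH lt; first by rewrite (e1 None).
  rewrite (e1 (Some k.+1)); last by apply/eqP; case; lia.
  have -> : cells k.+2 x e = cells k.+2 x (upd e p (Some k.+1)).
    apply: cells_eq => q j le; rewrite /upd; case: (_ =P p) => // ->.
    by rewrite ep addn0; apply/eqP/eqP => -[]; lia.
  rewrite (_ : (_, false) = aux0) // (@isweep_adv_done _ _ _ _ _ k.+1) //;
    last by rewrite /upd eqxx.
  congr (_, _ :: _ :: _).
  rewrite /setp; congr pair; apply/ffunP=> q; rewrite !ffunE /upd.
  by case: (_ =P p) => // _; rewrite eqxx.
have -> : [ffun p0 => e p0 == Some k] p = false.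
  by rewrite ffunE ep; apply/eqP; case; lia.
rewrite (IH k.+1 i) //; last by rewrite ep addSnnS.
rewrite eqSS; congr (_, _ :: _).
  congr pair; apply/ffunP=> q; rewrite !ffunE /upd.
  case: (_ =P p) => // ->; rewrite ep; apply/eqP/eqP; first by case; lia.
  by case: ifP => // _ [] ; lia.
by rewrite addSnnS.
Qed.

Definition code_at (o : nat) (p : seq instr) : Prop :=
  forall i, i < size p -> o + i < size code /\ cur (o + i) = nth IConv p i.

Lemma code_at_cat o p q : code_at o (p ++ q) ->
  code_at o p /\ code_at (o + size p) q.
Proof.
move=> H; split=> i lt.
  by have := H i; rewrite size_cat nth_cat lt; apply; lia.
have := H (size p + i); rewrite size_cat nth_cat ltn_add2l lt addnA.
by rewrite ifF 1?addKn //; [apply | lia].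
Qed.

Lemma code_at_cons o I p : code_at o (I :: p) ->
  [/\ o < size code, cur o = I & code_at o.+1 p].
Proof.
move=> H; have [h1 h2] := H 0 isT; rewrite addn0 in h1 h2; split=> // i lt.
by have := H i.+1 lt; rewrite addnS.
Qed.

(** The region is restored and only the output grows: [wf] keeps the pebble of a loop distinct from
    those in use, so it is off the tape before the loop, and the last [IAdv] removes it again. *)
Theorem compile_correct c A o e x j out :
  wf A c -> (forall p, e p <> None -> p \in A) -> code_at o (compile o c) ->
  reach (cost (size x) c)
    (at_pc o, tape j (cells 0 x e) out)
    (at_pc (o + clen c), tape j (cells 0 x e) (out ++ eval x c e)).
Proof.
elim: c A o e out => [|d|a IHa b IHb|r a IHa b IHb|p a IH] A o e out /=.
- by move=> _ _ _; rewrite addn0 cats0; apply: reach0.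
- move=> _ _ /code_at_cons[lt E _].
  have := @reach1 o j (cells 0 x e) out; rewrite E /= => /(_ I lt).
  by rewrite isweep_id //= addn1 cats1.
- move=> /andP[wa wb] He /code_at_cat[ca]; rewrite size_compile => cb.
  rewrite catA addnA.
  exact: reach_trans (IHa _ _ _ out wa He ca) (IHb _ _ _ _ wb He cb).
- move=> /andP[wa wb] He /code_at_cons[lt E].
  move=> /code_at_cat[ca]; rewrite size_compile => /code_at_cons[lt2 E2 cb].
  have := @reach1 o j (cells 0 x e) out; rewrite E => /(_ I lt).
  have [q ->] := isweep_test r (o + clen a + 2) (cells 0 x e) aux0.
  rewrite [_ || _]/=; case: (holds _ _ _) => /= R1.
    apply: (@reach_le (1 + (cost (size x) a + 1))); first by lia.
    apply: (reach_trans R1); apply: (reach_trans (IHa _ _ _ out wa He ca)).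
    have := @reach1 (o.+1 + clen a) j (cells 0 x e) (out ++ eval x a e).
    rewrite E2 isweep_id //= => /(_ I lt2).
    by congr (reach _ _ (at_pc _, _)); lia.
  apply: (@reach_le (1 + cost (size x) b)); first by lia.
  apply: (reach_trans R1).
  have -> : o + (2 + clen a + clen b) = o + clen a + 2 + clen b by lia.
  have Eo : (o.+1 + clen a).+1 = o + clen a + 2 by lia.
  by rewrite Eo in cb; apply: IHb wb He cb.
move=> /andP[pA wa] He /code_at_cons[lt E].
move=> /code_at_cat[ca]; rewrite size_compile => /code_at_cons[lt2 E2 _].
have ep : e p = None.
  by case Ep: (e p) => [v|] //; have := He p; rewrite Ep (negPf pA) => H; have := H (fun h => ltac:(discriminate h)).
have := @reach1 o j (cells 0 x e) out; rewrite E => /(_ I lt).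
rewrite isweep_place //=; have [x0 | xn] := eqVneq x [::].
  by rewrite x0 /= mul0n addn0 cats0; congr (reach _ _ (at_pc _, _)); lia.
move=> R1.
(* Induction on the rounds that follow the current one, with the pebble at position [i]. *)
have loop : forall n i out, i + n.+1 = size x ->
  reach (n.+1 * (cost (size x) a).+1)
   (at_pc o.+1, tape j (cells 0 x (upd e p (Some i))) out)
   (at_pc (o + (2 + clen a)), tape j (cells 0 x e) 
     (out ++ flatten [seq eval x a (upd e p (Some i)) | i <- iota i n.+1])).
  elim=> [|n IHn] i out' Ei.
    rewrite mul1n /= cats0 -addn1; apply: reach_trans.
      apply: IH wa _ ca => q; rewrite inE /upd; case: (_ =P p) => //= _; exact: He.
    have := @reach1 (o.+1 + clen a) j (cells 0 x (upd e p (Some i))) (out' ++ eval x a (upd e p (Some i))).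
    rewrite E2 (@isweep_adv p o.+1 0 x _ i); try (by rewrite /upd eqxx); last by lia.
    rewrite (_ : i.+1 == size x) => [|]; last by apply/eqP; lia.
    move=> /(_ I lt2) /=.
    rewrite (@cells_eq 0 x (upd (upd e p (Some i)) p None) e) => [|q i' _].
      by congr (reach _ _ (at_pc _, _)); lia.
    by rewrite /upd; case: (_ =P p) => // ->; rewrite ep.
  rewrite mulSn -addn1 [iota _ _]/= [map _ _]/= [flatten _]/= catA -!addnA.
  apply: reach_trans.
    apply: IH wa _ ca => q; rewrite inE /upd; case: (_ =P p) => //= _; exact: He.
  have := @reach1 (o.+1 + clen a) j (cells 0 x (upd e p (Some i))) (out' ++ eval x a (upd e p (Some i))).
  rewrite E2 (@isweep_adv p o.+1 0 x _ i); try (by rewrite /upd eqxx); last by lia.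
  rewrite (_ : i.+1 == size x = false) => [|]; last by apply/eqP; lia.
  move=> /(_ I lt2) /= R2; apply: reach_trans R2 _.
  have := IHn i.+1 (out' ++ eval x a (upd e p (Some i))); rewrite addSnnS.
  rewrite (@cells_eq 0 x (upd (upd e p (Some i)) p (Some (0 + i).+1)) (upd e p (Some i.+1))).
    by rewrite addn1; apply.
  by move=> q i' _; rewrite /upd; case: (_ =P p).
apply: reach_trans R1 _.
have sx : 0 < size x by rewrite lt0n size_eq0.
by have := loop (size x).-1 0 out; rewrite (prednK sx); apply.
Qed.

End Exec.

Variables (dbit : bool -> D) (bitd : D -> bool).

Lemma cost_mono c m n : m <= n -> cost m c <= cost n c.
Proof.
move=> le; elim: c => //= [a IHa b IHb|r a IHa b IHb|p a IH]; try lia.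
by rewrite leq_add2l leq_mul.
Qed.

Lemma polyb_cost c : polyb (fun n => cost n c).
Proof.
elim: c => //= *; do ?[exact: polyb_const | exact: polyb_id | apply: polyb_add
  | apply: polyb_mul | apply: polyb_succ]; assumption.
Qed.

(** Through [IConv] the output of [p1] becomes the region of [p2], whose loop counters can therefore
    range over a polynomially longer word than the input. *)
Theorem transducer_poly (p1 p2 : prog) : wf [::] p1 -> wf [::] p2 ->
  poly_time_computable
    (fun w => map bitd (eval (eval (map dbit w) p1 env0) p2 env0)).
Proof.
move=> w1 w2.
pose code := compile 0 p1 ++ IConv :: compile (clen p1).+1 p2.
have sc : size code = clen p1 + (clen p2).+1.
  by rewrite size_cat /= !size_compile.
pose inp b := SCell (dbit b, [ffun=> false]).
(* Dead cells and the region yield no bit, so the final search stops at the first symbol emitted by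
   [p2]. *)
pose out (s : tape_sym) := if s is inl (inr d) then Some (bitd d) else None.
pose T n := cost n p1 + (1 + cost (cost n p1) p2).
have pT : polyb (fun n => (T n).+1 * ((n + T n).*2 + 4) + 2).
  have pT : polyb T.
    apply: polyb_add; first exact: polyb_cost.
    apply: polyb_add; first exact: polyb_const.
    by apply: (@polyb_comp (fun n => cost n p2) (fun n => cost n p1)); exact: polyb_cost.
  apply: polyb_add; last exact: polyb_const.
  apply: polyb_mul; first exact: polyb_succ.
  apply: polyb_add; last exact: polyb_const.
  apply: (@polyb_le _ (fun n => 2 * (n + T n))); first by move=> n; lia.
  apply: polyb_mul; first exact: polyb_const.
  by apply: polyb_add => //; exact: polyb_id.
have [c Hc] := polyb_bound pT.
exists (@sweeper (ctl code) tape_sym (@ctl_delta code) (@ctl_fin code)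
  (at_pc code 0) (@ctl_done code) inp out), c => w.
set x := map dbit w; set x1 := eval x p1 env0; set o := eval x1 p2 env0.
have e0 : map inp w = tape 0 (cells 0 x env0) [::].
  rewrite /tape /= cats0 /x; move: 0; elim: (w) => //= b v IH k.
  by rewrite -IH; congr (inl (inl (dbit b, _)) :: _); apply/ffunP=> q; rewrite !ffunE.
have r1 : @reach code (cost (size x) p1) (at_pc code 0, map inp w)
   (at_pc code (clen p1), tape 0 (cells 0 x env0) x1).
  rewrite e0; apply: (@compile_correct code _ [::]) => //.
  move=> i lt; split; last by rewrite add0n /cur /code nth_cat lt.
  by rewrite size_compile in lt; rewrite sc; lia.
have r2 : @reach code 1 (at_pc code (clen p1), tape 0 (cells 0 x env0) x1)
   (at_pc code (clen p1).+1, tape (size x) (cells 0 x1 env0) [::]).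
  have lt : clen p1 < size code by rewrite sc; lia.
  exists 1 => //; split.
    have := @step_conv code (clen p1) (cells 0 x env0) x1.
    rewrite (_ : size (cells _ _ _) = size x); last first.
      by move: 0; elim: (x) => //= d y IH k; rewrite IH.
    by apply=> //; rewrite /cur nth_cat size_compile ltnn subnn.
  by case=> // _; rewrite /ctl_done /= inordK; lia.
have r3 : @reach code (cost (size x1) p2) 
   (at_pc code (clen p1).+1, tape (size x) (cells 0 x1 env0) [::])
   (at_pc code (size code), tape (size x) (cells 0 x1 env0) o).
  rewrite sc addnS -addSn; apply: (@compile_correct code _ [::]) => //.
  move=> i; rewrite size_compile => lt; rewrite /cur /code nth_cat size_cat /= !size_compile.
  split; first lia.
  by rewrite ifF; [rewrite addSn subSn ?addKn // leq_addr | lia].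
have [k lek [Ek Hk]] := reach_trans r1 (reach_trans r2 r3).
have dn : ctl_done (at_pc code (size code)) by rewrite /ctl_done /= inordK.
have [N leN [H1 H2]] := @sweeper_correct _ _ _ _ _ _ _ out _ _ _ _ Ek dn Hk.
exists N.
  apply: leq_trans leN (leq_trans _ (Hc _)).
  have lekT : k <= T (size w).
    apply: leq_trans lek _; rewrite /T /x size_map !leq_add2l.
    by apply: cost_mono; apply: leq_trans (size_eval _ _ _) _; rewrite size_map.
  by rewrite leq_add2r leq_mul // ?ltnS // leq_add2r leq_double leq_add2l.
split=> //; rewrite H2.
have -> y : drop (find out (tape (size x) y o)) (tape (size x) y o) = map SEm o.
  elim: (size x) => //=; rewrite /tape /=; elim: y => //=.
  by case: (o).
by elim: (o) => //= d o' ->.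
Qed.

End Prog.

(** * Decoding instances *)

Fixpoint of_bits (s : seq bool) : nat :=
  if s is b :: s' then b + (of_bits s').*2 else 0.

Lemma of_bits_gt0 (b : bool) s : last b s -> 0 < of_bits (b :: s).
Proof. by elim: s b => [|c s IH] b /= => [|/IH /=]; [case: b | lia]. Qed.

Lemma of_bitsK s : last true s -> bits (of_bits s) = s.
Proof.
rewrite /bits => can; have : of_bits s <= of_bits s by [].
elim: s {2 3}(of_bits s) can => [|b s IH] [|f] // can le.
  by have := @of_bits_gt0 b s can; lia.
have := @of_bits_gt0 b s can; rewrite /= in le *; move=> pos.
rewrite gtn_eqF // oddD odd_double addbF halfD odd_double andbF add0n doubleK.
have -> : b./2 = 0 by case: (b).
rewrite oddb add0n IH //; first by case: s can {IH le pos}.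
by case: (b) pos le; lia.
Qed.

Lemma bitsK n : of_bits (bits n) = n.
Proof.
rewrite /bits; have := leqnn n; move: {2 3}n => f.
elim: f n => [|f IH] n /= le; first by lia.
case: eqP => [->//|n0] /=; rewrite IH; last by lia.
by rewrite odd_double_half.
Qed.

(** A left inverse of the encoding: [bs] collects the digits of the current variable, [ls] the
    literals of the current clause, and [None] marks the end of the formula. *)
Fixpoint parse (bs : seq bool) (ls : seq literal) (w : seq bool) :
    seq (option (seq literal)) :=
  match w with
  | false :: false :: b :: w' => parse (rcons bs b) ls w'
  | false :: true :: b :: w' => parse [::] (rcons ls (of_bits bs, ~~ b)) w'
  | true :: false :: false :: w' => Some ls :: parse [::] [::] w'
  | true :: _ :: _ :: w' => None :: parse bs ls w'
  | _ => [::]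
  end.

Lemma parse_lit l ls w : parse [::] ls (enc_lit l ++ w) = parse [::] (rcons ls l) w.
Proof.
case: l => n b; rewrite /enc_lit -catA /=.
have H bs s : parse bs ls (flatten [seq (if b0 then sym1 else sym0) | b0 <- s] ++
   (if b then symPos else symNeg) ++ w) = parse [::] (rcons ls (of_bits (bs ++ s), b)) w.
  elim: s bs => [|c s IH] bs /=; first by rewrite cats0; case: b.
  by rewrite -cat_rcons -IH; case: c.
by rewrite H bitsK.
Qed.

Lemma parse_clause c w :
  parse [::] [::] (enc_clause c ++ w) = Some c :: parse [::] [::] w.
Proof.
rewrite /enc_clause -catA -[in RHS](cat0s c).
elim: c {1 2}(@nil literal) => [|l c IH] ls; first by rewrite cats0.
by rewrite /= -catA parse_lit IH cat_rcons.
Qed.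

Lemma parse_instance Fs gs ds : parse [::] [::] (enc_instance Fs gs ds) =
  map Some Fs ++ [:: None; Some gs; Some ds].
Proof.
rewrite /enc_instance; elim: Fs => [|F Fs IH] /=; last by rewrite -catA parse_clause IH.
by rewrite parse_clause -[enc_clause ds]cats0 parse_clause.
Qed.

(** [ORP_lang] accepts a word if some instance encoded by it is positive; by injectivity the
    instance printed by the reduction is the only candidate. *)
Lemma enc_instance_inj Fs gs ds Fs' gs' ds' :
  enc_instance Fs gs ds = enc_instance Fs' gs' ds' ->
  [/\ Fs = Fs', gs = gs' & ds = ds'].
Proof.
move/(congr1 (parse [::] [::])); rewrite !parse_instance.
elim: Fs Fs' => [|F Fs IH] [|F' Fs'] //=; first by case=> -> ->.
by case=> -> /IH[-> -> ->].
Qed.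

(** * Size of refutations *)

Definition leafb (P : seq pnode) (D : clause) : bool :=
  has (fun nd => if nd is PLeaf C then C == D else false) P.

Lemma leafbP P D :
  reflect (exists2 k, k < size P & nth pdefault P k = PLeaf D) (leafb P D).
Proof.
apply: (iffP (has_nthP pdefault)) => -[k lt]; last by move=> E; exists k; rewrite // E eqxx.
by case E: nth => [C|//] /eqP <-; exists k.
Qed.

(** Descend from the empty clause: if [v] falsifies a resolvent on [x], it falsifies the parent
    whose literal on [x] it makes false. *)
Lemma falsified_leaf F P (v : nat -> bool) : is_res_proof F P ->
  exists D, [/\ leafb P D, D \in F & forall l, l \in D -> v l.1 != l.2].
Proof.
case=> s0 val root0 _.
have H : forall n k, k < n -> k < size P ->
    (forall l, l \in plabel P k -> v l.1 != l.2) ->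
    exists D, [/\ leafb P D, D \in F & forall l, l \in D -> v l.1 != l.2].
  elim=> // n IH k le lt; move: (val k lt); rewrite /valid_node /plabel.
  case E: nth => [C|i j x C] /=.
    by move=> CF H; exists C; split=> //; apply/leafbP; exists k.
  case=> lti ltj xi xj -> H.
  case vx: (v x).
    apply: (IH j); [lia | lia |] => l lj; case: (l =P (x, false)) => [->|/eqP n1].
      by rewrite vx.
    by apply: H; rewrite !inE n1 lj orbT.
  apply: (IH i); [lia | lia |] => l li; case: (l =P (x, true)) => [->|/eqP n1].
    by rewrite vx.
  by apply: H; rewrite !inE n1 li.
apply: (H (size P) (root P)); rewrite /root ?prednK //.
by move: root0; rewrite /root => -> l; rewrite inE.
Qed.

(* Every node but the root is one of the two parents of some inner node. *)
Lemma leaves_bound F P (s : seq clause) : is_res_proof F P ->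
  uniq s -> {subset s <= leafb P} -> (size s).*2 <= (size P).+1.
Proof.
case=> s0 val _ child us sub.
pose L := [seq k <- iota 0 (size P) | is_leaf P k].
pose R := [seq k <- iota 0 (size P) | ~~ is_leaf P k].
have sLR : size L + size R = size P.
  by rewrite !size_filter count_predC size_iota.
have sL : size s <= size L.
  rewrite -(size_map (plabel P) L); apply: uniq_leq_size => // D /sub.
  case/leafbP=> k lt E; apply/mapP; exists k; last by rewrite /plabel E.
  by rewrite mem_filter mem_iota /is_leaf E.
pose par k := if nth pdefault P k is PRes i j _ _ then [:: i; j] else [::].
have sR : root P <= (size R).*2.
  rewrite -(size_iota 0 (root P)).
  have -> : (size R).*2 = size (flatten (map par R)).
    have : all (fun k => ~~ is_leaf P k) R by apply: filter_all.
    elim: R {sLR} => //= k R IH /andP[nl /IH aR].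
    rewrite size_cat -aR doubleS; move: nl; rewrite /is_leaf /par.
    by case: nth.
  apply: uniq_leq_size; first exact: iota_uniq.
  move=> k; rewrite mem_iota /= add0n => /child[m ltm]; rewrite /is_parent => pm.
  apply/flattenP; exists (par m).
    apply: map_f; rewrite mem_filter mem_iota ltm /is_leaf /=.
    by case: nth pm.
  by rewrite /par; case: nth pm => // i j _ _; rewrite !inE.
rewrite /root in sR; lia.
Qed.

Lemma uniq_pmap_in (T : eqType) (U : eqType) (f : T -> option U) (s : seq T) :
  uniq s -> {in s &, forall a b v, f a = Some v -> f b = Some v -> a = b} ->
  uniq (pmap f s).
Proof.
elim: s => //= a s IH /andP[as_ us] inj.
have us' : uniq (pmap f s).
  by apply: IH => // x y xs ys; apply: inj; rewrite inE ?xs ?ys orbT.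
case E: (f a) => [v|] //=; rewrite us' andbT mem_pmap; apply/mapP=> -[b bs Eb].
by case/negP: as_; rewrite (inj a b _ _ v) // inE ?eqxx ?bs ?orbT.
Qed.

(** The nodes are listed as [C 0], [D 0], [C 1], [D 1], and so on: node [i.*2] carries [C i] and
    node [i.*2.+1] is the leaf [D i]. Regularity holds because every variable is resolved once in
    the whole proof. *)
Lemma input_chain F m (C D : nat -> clause) (x : nat -> nat) :
  C 0 \in F -> (forall i, i < m -> D i \in F) ->
  (forall i, i < m -> (x i, true) \in D i) ->
  (forall i, i < m -> (x i, false) \in C i) ->
  (forall i, i < m -> C i.+1 = resolvent (D i) (C i) (x i)) ->
  C m = fset0 ->
  (forall i j, i < m -> j < m -> x i = x j -> i = j) ->
  exists P, [/\ is_res_proof F P, regular P, size P = m.*2.+1 &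
    0 < m -> contains_res_of_leaves P (D 0) (C 0)].
Proof.
move=> C0 DF xD xC CS Cm xinj.
pose nd k := if k == 0 then PLeaf (C 0) else
  if odd k then PLeaf (D k./2) else PRes k.-1 k.-2 (x k./2.-1) (C k./2).
pose P := mkseq nd m.*2.+1.
have sP : size P = m.*2.+1 by rewrite size_mkseq.
have nP k : k < m.*2.+1 -> nth pdefault P k = nd k by move=> lt; rewrite nth_mkseq.
have ndE i : nd i.*2.+2 = PRes i.*2.+1 i.*2 (x i) (C i.+1).
  by rewrite /nd /= negbK odd_double /= doubleK.
have ndO i : nd i.*2.+1 = PLeaf (D i).
  by rewrite /nd /= odd_double /= uphalf_double.
have lab i : i <= m -> plabel P i.*2 = C i.
  move=> le; rewrite /plabel nP; last by lia.
  by case: i le => // i le; rewrite doubleS ndE.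
have labO i : i < m -> plabel P i.*2.+1 = D i.
  by move=> le; rewrite /plabel nP ?ndO //; lia.
have cases k : [\/ k = 0, exists i, k = i.*2.+1 | exists i, k = i.*2.+2].
  case: k => [|k]; first by constructor 1.
  rewrite -(odd_double_half k); case: odd; first by constructor 3; exists k./2.
  by constructor 2; exists k./2.
have parE k l : k < size P -> is_parent P k l ->
    exists2 i, k = i.*2.+2 & (l == i.*2.+1) || (l == i.*2).
  rewrite sP /is_parent => lt; rewrite nP //.
  by have [->|[i ->]|[i ->]] := cases k; rewrite ?ndO ?ndE //; exists i.
exists P; split=> //.
- split; first by rewrite sP.
  + move=> k; rewrite sP => lt; rewrite /valid_node nP //.
    move: lt; have [->|[i ->]|[i ->]] := cases k => lt; first by [].
      by rewrite ndO; apply: DF; lia.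
    have im : i < m by lia.
    rewrite ndE; split; rewrite ?labO ?lab //; try lia; [exact: xD | exact: xC | exact: CS].
  + by rewrite /root sP /= lab.
  + rewrite /root sP /= => k lt; rewrite /is_parent.
    have lt' : (k./2).*2.+2 < m.*2.+1 by lia.
    exists (k./2).*2.+2; first by [].
    rewrite nP // ndE; have := odd_double_half k.
    by case: (odd k) => /= E; apply/orP; [left | right]; apply/eqP; lia.
- move=> s ps _.
  (* Parents have smaller indices, so a path from the root strictly decreases and repeats no
     node. *)
  have [us all_s] : uniq (root P :: s) /\ all (fun k => k < size P) (root P :: s).
    have rP : root P < size P by rewrite /root sP.
    have : sorted gtn (root P :: s) /\ all (fun k => k < size P) (root P :: s).
      elim: s (root P) rP ps => [|l s IH] r lt /=; first by rewrite lt.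
      move=> /andP[pr pl]; have [i Er El] := parE _ _ lt pr.
      have ltl : l < r by case/orP: El => /eqP->; lia.
      have [|h1 h2] := IH l _ pl; first by lia.
      by rewrite ltl lt; move: h1 => /= ->.
    case=> so al; split=> //; apply: (sorted_uniq _ _ so).
      by move=> a b c /= ? ?; lia.
    by move=> a; rewrite /= ltnn.
  apply: uniq_pmap_in us _ => a b /(allP all_s) la /(allP all_s) lb v.
  rewrite sP in la lb; rewrite /res_var !nP //.
  move: la lb.
  have [->|[i ->]|[i ->]] := cases a; have [->|[j ->]|[j ->]] := cases b;
    rewrite ?ndO ?ndE // => la lb [<-] [E].
  by rewrite (xinj _ _ _ _ E) //; lia.
move=> m0; exists 2, 1, 0, (x 0), (C 1); split; first by rewrite sP; lia.
  by rewrite nP; [exact: (ndE 0) | lia].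
by left; rewrite !nP; [rewrite (ndO 0) | lia..].
Qed.

(** * Horn clauses and linear input refutations *)

Section Horn.
Variables (V : eqType) (nm : V -> nat).
Hypothesis nm_inj : injective nm.

Definition horn (p : option V) (ns : seq V) : clause :=
  clause_of ([seq (nm u, true) | u <- seq_of_opt p] ++ [seq (nm u, false) | u <- ns]).

Lemma mem_clause_of c l : (l \in clause_of c) = (l \in c).
Proof. exact: seq_fsetE. Qed.

Lemma horn_pos p ns u : ((nm u, true) \in horn p ns) = (p == Some u).
Proof.
rewrite mem_clause_of mem_cat; apply/orP/eqP => [[]|->].
- by case: p => [x|//]; rewrite inE => /eqP[/nm_inj ->].
- by case/mapP.
- by left; rewrite inE.
Qed.

Lemma horn_neg p ns u : ((nm u, false) \in horn p ns) = (u \in ns).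
Proof.
rewrite mem_clause_of mem_cat; apply/orP/idP => [[]|H].
- by case/mapP.
- by case/mapP=> x xs [/nm_inj ->].
- by right; apply/mapP; exists u.
Qed.

Lemma horn_inj p ns p' ns' : horn p ns = horn p' ns' -> p = p' /\ ns =i ns'.
Proof.
move=> E; split; last by move=> u; rewrite -(horn_neg p) E horn_neg.
have H u : (p == Some u) = (p' == Some u) by rewrite -(horn_pos p ns) E horn_pos.
case: p H {E} => [x|]; first by move/(_ x); rewrite eqxx => /esym/eqP.
by case: p' => [x|//] /(_ x); rewrite eqxx.
Qed.

Lemma horn_nilP p ns : p = None -> ns =i [::] -> horn p ns = fset0.
Proof.
move=> -> E; apply/fsetP=> l; rewrite inE mem_clause_of /=; apply/mapP=> -[u].
by rewrite E.
Qed.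

Lemma resolvent_horn x ns N :
  resolvent (horn (Some x) ns) (horn None N) (nm x) =
  horn None (ns ++ filter (predC1 x) N).
Proof.
apply/fsetP=> -[v b]; rewrite in_fsetU !in_fsetD1 !mem_clause_of !mem_cat /= inE.
apply/idP/idP.
  case/orP=> /andP[/eqP n1].
    case/orP=> [/eqP//|/mapP[u us [-> ->]]].
    by apply/mapP; exists u; rewrite // mem_cat us.
  case/mapP=> u us [Ev Eb]; rewrite Ev Eb; apply/mapP; exists u => //.
  rewrite mem_cat mem_filter us andbT /=; apply/orP; right; apply/eqP=> ux.
  by apply: n1; rewrite Ev Eb ux.
case/mapP=> u; rewrite mem_cat mem_filter /= => us [-> ->].
rewrite !xpair_eqE !andbF /= andbT (inj_eq nm_inj) !(mem_map (f := fun u => (nm u, false))).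
  by rewrite orbC; case/orP: us => [->|/andP[-> ->]]; rewrite ?orbT.
- by move=> y z [/nm_inj].
- by move=> y z [/nm_inj].
Qed.

(* The pending negative variables of a linear input refutation, when resolving
   successively with the clauses [x \/ ~ns] of the list [ds]. *)
Definition pending (N : seq V) (d : V * seq V) := d.2 ++ filter (predC1 d.1) N.

Fixpoint refutes (N : seq V) (ds : seq (V * seq V)) : Prop :=
  if ds is d :: ds' then d.1 \in N /\ refutes (pending N d) ds' else N =i [::].

Lemma refutes_eq N N' ds : N =i N' -> refutes N ds -> refutes N' ds.
Proof.
elim: ds N N' => [|d ds IH] N N' E /=; first by move=> H u; rewrite -E.
rewrite -E => -[-> H]; split=> //; apply: IH H => u.
by rewrite !mem_cat !mem_filter E.
Qed.

Lemma refutes_units xs N : uniq xs -> N =i xs -> refutes N [seq (x, [::]) | x <- xs].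
Proof.
elim: xs N => //= x xs IH N /andP[xn us] E; rewrite E inE eqxx; split=> //.
apply: IH => // u; rewrite /pending mem_filter /= E inE.
by case: (u =P x) => // ->; rewrite (negPf xn).
Qed.

(** The centre clauses of [input_chain] are the purely negative clauses on the pending variables.
    Only the first resolution has two leaves as parents, so it is the one that is exhibited. *)
Lemma refutes_chain F N d0 ds : let ds' := d0 :: ds in
  refutes N ds' -> uniq (map fst ds') ->
  horn None N \in F -> {in ds', forall d, horn (Some d.1) d.2 \in F} ->
  exists P, [/\ is_res_proof F P, regular P, size P = (size ds').*2.+1 &
    contains_res_of_leaves P (horn (Some d0.1) d0.2) (horn None N)].
Proof.
move=> ds' ref us NF dF.
pose M i := foldl pending N (take i ds').
have [H1 H2] : (forall i, i < size ds' -> (nth d0 ds' i).1 \in M i) /\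
    M (size ds') =i [::].
  rewrite /M; elim: ds' N ref {us NF dF M} => [|d s IH] N //= [dN /IH[h1 h2]].
  by split=> // -[|i] // /h1.
have [|i lt|i lt|i lt|i lt||i j li lj|P [h1 h2 h3 h4]] :=
  @input_chain F (size ds') (fun i => horn None (M i))
    (fun i => horn (Some (nth d0 ds' i).1) (nth d0 ds' i).2)
    (fun i => nm (nth d0 ds' i).1).
- by rewrite /M take0.
- exact/dF/mem_nth.
- by rewrite horn_pos.
- by rewrite horn_neg; apply: H1.
- rewrite resolvent_horn; congr horn.
  by rewrite /M (take_nth d0) // foldl_rcons.
- exact: horn_nilP.
- move/nm_inj/eqP; rewrite -!(nth_map d0 d0.1 fst) //.
  by rewrite nth_uniq ?size_map // => /eqP.
exists P; split=> //.
by have := h4 isT; rewrite /M take0.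
Qed.

End Horn.

(** * Selections as short refutations *)

Section Selection.
Variables (J C G Y : finType) (opt : J -> C -> G -> bool).

Definition hvar : finType := (unit + J + C * G + Y)%type.
Definition HG : hvar := inl (inl (inl tt)).
Definition HS (j : J) : hvar := inl (inl (inr j)).
Definition HA (c : C) (g : G) : hvar := inl (inr (c, g)).
Definition HY (y : Y) : hvar := inr y.

Variables (nm : hvar -> nat) (F : seq clause).
Hypothesis nm_inj : injective nm.
Notation horn := (horn nm).

Definition goal1 := horn None (HG :: map HS (enum J)).
Definition goal2 := horn None (map HY (enum Y)).

(** A predicate rather than a list, since the printing loops may repeat clauses and fix their own
    order. *)
Definition selection_clause (D : clause) : Prop :=
  D = goal1 \/ D = horn (Some HG) [::] \/
  (exists j c g, opt j c g /\ D = horn (Some (HS j)) [:: HA c g]) \/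
  (exists c g, D = horn (Some (HA c g)) [::]) \/
  D = goal2 \/ (exists y, D = horn (Some (HY y)) [::]).

Hypothesis FE : forall D, D \in F <-> selection_clause D.

Hypothesis local : forall c, exists j, forall c' g, opt j c' g -> c' = c.

Definition selects (t : C -> G) := forall j, exists c, opt j c (t c).

Let k := #|J| + #|C|.

Lemma HS_inj : injective HS. Proof. by move=> a b []. Qed.
Lemma HY_inj : injective HY. Proof. by move=> a b []. Qed.

(** After [HG], each goal literal is traded for the content literal that serves it, and the units
    then remove the content literals. Equal content literals merge, so there is one unit per cell,
    and the count of resolutions is 1 + #|J| + #|C|. *)
Lemma proof1 t : selects t ->
  exists P, [/\ is_res_proof F P, regular P, size P = (k.+1).*2.+1 &
    contains_res_of_leaves P (horn (Some HG) [::]) goal1].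
Proof.
move=> st; have [a Ha] := fin_all_exists st.
pose A j := HA (a j) (t (a j)).
pose units := [seq HA c (t c) | c <- enum C].
pose ds := [seq (HS j, [:: A j]) | j <- enum J] ++ [seq (x, [::]) | x <- units].

(* Here [M] holds the content literals introduced so far. Every cell occurs in [M] or is used by a
   goal still in [js], so each unit finds its literal in the end; initially this is [local]. *)
have stage js M : uniq js ->
    (forall c, (HA c (t c) \in M) || has (fun j => a j == c) js) ->
    {subset M <= units} ->
    refutes (M ++ map HS js)
      ([seq (HS j, [:: A j]) | j <- js] ++ [seq (x, [::]) | x <- units]).
  elim: js M => [|j js IH] M /= us H1 H2.
    apply: refutes_units.
      by rewrite map_inj_uniq ?enum_uniq // => c c' [].
    move=> u; rewrite cats0; apply/idP/idP => [/H2//|/mapP[c _ ->]].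
    by have := H1 c; rewrite orbF.
  split; first by rewrite mem_cat inE eqxx orbT.
  case/andP: us => jn us.
  apply: (@refutes_eq _ ((A j :: M) ++ map HS js)); last apply: IH => //.
  + move=> u; rewrite /pending mem_cat in_cons !mem_cat mem_filter !mem_cat !in_cons /=.
    rewrite in_nil orbF; case: (u =P HS j) => [->|_] /=; last by rewrite orbA.
    rewrite (_ : HS j \in M = false); last by apply/negP=> /H2 /mapP[].
    by rewrite mem_map ?(negPf jn) //; exact: HS_inj.
  + move=> c; have := H1 c; rewrite in_cons; case/or3P=> [->|/eqP <-|->]; rewrite ?orbT //.
    by rewrite eqxx.
  + move=> u; rewrite in_cons => /orP[/eqP ->|/H2 //].
    by apply/mapP; exists (a j); rewrite ?mem_enum.
have [|||d|P] := @refutes_chain _ _ nm_inj F (HG :: map HS (enum J)) (HG, [::]) ds.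
- split; first by rewrite inE eqxx.
  apply: (@refutes_eq _ ([::] ++ map HS (enum J))).
    move=> u; rewrite /pending mem_filter in_cons /=.
    by case: (u =P HG) => // ->; apply/mapP=> -[].
  apply: stage => // [|c]; first exact: enum_uniq.
  have [j Hj] := local c; apply/orP; right; apply/hasP; exists j.
    by rewrite mem_enum.
  by rewrite (Hj _ _ (Ha j)).
- rewrite /= /ds map_cat -!map_comp cat_uniq mem_cat; apply/and4P; split.
  + by apply/negP => /orP[] /mapP[].
  + by rewrite map_inj_uniq -?enumT ?enum_uniq //; move=> x y [].
  + by apply/hasPn => u /mapP[c _ ->]; apply/mapP=> -[].
  + by rewrite map_inj_uniq -?enumT ?enum_uniq // => c c' [].
- by apply/FE; left.
- rewrite inE => /orP[/eqP->|]; first by apply/FE; right; left.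
  rewrite mem_cat => /orP[/mapP[j _ ->]|/mapP[u /mapP[c _ ->] ->]] /=.
    by apply/FE; right; right; left; exists j, (a j), (t (a j)).
  by apply/FE; do 3!right; left; exists c, (t c).
by case=> h1 h2 h3 h4; exists P; split=> //; rewrite h3 -cat1s !size_cat !size_map -?enumT -!cardE.
Qed.

(** The unit of [y0] is resolved first, so that its partner is the leaf [goal2] itself. *)
Lemma proof2 (y0 : Y) :
  exists P, [/\ is_res_proof F P, regular P, size P = #|Y|.*2.+1 &
    contains_res_of_leaves P (horn (Some (HY y0)) [::]) goal2].
Proof.
pose ys := map HY (y0 :: rem y0 (enum Y)).
have us : uniq ys.
  rewrite map_inj_uniq; last exact: HY_inj.
  by rewrite /= rem_uniq ?enum_uniq // mem_rem_uniq ?enum_uniq // !inE eqxx.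
have eys : map HY (enum Y) =i ys.
  apply/perm_mem/perm_map/perm_to_rem; by rewrite mem_enum.
have [|||d|P] := @refutes_chain _ _ nm_inj F (map HY (enum Y)) (HY y0, [::])
  [seq (y, [::]) | y <- map HY (rem y0 (enum Y))].
- exact: (refutes_units us eys).
- by rewrite -[_ :: _]/[seq (y, [::]) | y <- ys] -map_comp map_id.
- by apply/FE; do 4!right; left.
- rewrite -[_ :: _]/[seq (y, [::]) | y <- ys] => /mapP[u /mapP[y _ ->] ->].
  by apply/FE; do 5!right; exists y.
case=> h1 h2 h3 h4; exists P; split=> //.
rewrite h3 /= !size_map size_rem ?mem_enum // -cardE prednK //.
by apply/card_gt0P; exists y0.
Qed.

(* The leaves are falsified by the assignment making true exactly what they
   derive by unit propagation. *)
Lemma leaves_cases P : is_res_proof F P ->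
  (leafb P goal2 /\ forall y, leafb P (horn (Some (HY y)) [::])) \/
  [/\ leafb P goal1, leafb P (horn (Some HG) [::]) &
    exists (a : J -> C) (g : J -> G), forall j, 
      [/\ opt j (a j) (g j), leafb P (horn (Some (HS j)) [:: HA (a j) (g j)]) &
       leafb P (horn (Some (HA (a j) (g j))) [::])]].
Proof.
move=> prf.
pose good j (p : C * G) := [&& opt j p.1 p.2, leafb P (horn (Some (HS j)) [:: HA p.1 p.2]) &
       leafb P (horn (Some (HA p.1 p.2)) [::])].
pose tr (u : hvar) := if u is inl (inl (inr j)) then [exists p, good j p]
  else leafb P (horn (Some u) [::]).
pose v n := [exists u, (nm u == n) && tr u].
have vE u : v (nm u) = tr u.
  apply/existsP/idP => [[u' /andP[/eqP /nm_inj -> //]]|H].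
  by exists u; rewrite eqxx.
have [D [lD DF H]] := falsified_leaf v prf.
have neg_true u : (nm u, false) \in D -> tr u.
  by move/H; rewrite /= vE; case: (tr u).
have pos_false u : (nm u, true) \in D -> ~~ tr u.
  by move/H; rewrite /= vE; case: (tr u).
have unit_false u : (if u is inl (inl (inr j)) then False else True) ->
   D <> horn (Some u) [::].
  move=> nu E; have := pos_false u; rewrite E horn_pos // eqxx => /(_ isT)/negP; apply.
  have -> : tr u = leafb P (horn (Some u) [::]) by case: u nu {E} => [[[]|]|].
  by rewrite -E.
(* Leaves that are units or clauses serving a goal are satisfied, since [tr] is closed under unit
   propagation; the falsified leaf is thus [goal1] or [goal2]. *)
case/FE: DF => [E|[E|[[j [c [g [jcg E]]]]|[[c [g E]]|[E|[y E]]]]]].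
- right; split; [by rewrite -E | |].
    by apply: (neg_true HG); rewrite E horn_neg // inE eqxx.
  have Hj j : exists p, good j p.
    apply/existsP; apply: (neg_true (HS j)).
    by rewrite E horn_neg // inE orbC map_f ?mem_enum.
  have [f Hf] := fin_all_exists Hj.
  by exists (fun j => (f j).1), (fun j => (f j).2) => j; apply/and3P/Hf.
- by case: (unit_false HG).
- have /negP[] : ~~ tr (HS j) by apply: pos_false; rewrite E horn_pos.
  apply/existsP; exists (c, g); rewrite /good /= jcg -E lD /=.
  by apply: (neg_true (HA c g)); rewrite E horn_neg // inE.
- by case: (unit_false (HA c g)).
- left; split=> [|y]; first by rewrite -E.
  by apply: (neg_true (HY y)); rewrite E horn_neg // map_f ?mem_enum.
- by case: (unit_false (HY y)).
Qed.

Let hinj := horn_inj nm_inj.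

Lemma leaves2 P : leafb P goal2 -> (forall y, leafb P (horn (Some (HY y)) [::])) ->
  exists s : seq clause, [/\ uniq s, {subset s <= leafb P}, size s = #|Y|.+1 &
    forall D, D \in s -> D = goal2 \/ exists y, D = horn (Some (HY y)) [::]].
Proof.
move=> l2 ly; exists (goal2 :: [seq horn (Some (HY y)) [::] | y <- enum Y]); split.
- rewrite cons_uniq map_inj_uniq ?enum_uniq ?andbT; last by move=> y y' /hinj[[]].
  by apply/mapP=> -[y _ /hinj[]].
- by move=> D; rewrite in_cons => /orP[/eqP->|/mapP[y _ ->]] //; exact: ly.
- by rewrite /= size_map -cardE.
- move=> D; rewrite in_cons => /orP[/eqP->|/mapP[y _ ->]]; first by left.
  by right; exists y.
Qed.

(** The content of each cell is read off the goal that only this cell serves. Either every goal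
    agrees with this choice, which then selects, or some goal uses another content of its cell,
    whose unit is one more leaf. The shape of [s] excludes the clauses of the decoy units, which can
    then be counted in addition. *)
Lemma leaves1 P (a : J -> C) (g : J -> G) :
  leafb P goal1 -> leafb P (horn (Some HG) [::]) ->
  (forall j, [/\ opt j (a j) (g j), leafb P (horn (Some (HS j)) [:: HA (a j) (g j)]) &
       leafb P (horn (Some (HA (a j) (g j))) [::])]) ->
  exists s : seq clause, [/\ uniq s, {subset s <= leafb P},
    forall D, D \in s -> D = goal1 \/ exists u n, D = horn (Some u) n /\
       (if u is inr y then False else True),
    k.+2 <= size s & (exists t, selects t) \/ k.+3 <= size s].
Proof.
move=> l1 lg Ha; have [f Hf] := fin_all_exists local.
have af c : a (f c) = c by have [h _ _] := Ha (f c); exact: Hf h.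
pose t c := g (f c).
pose s0 := goal1 :: horn (Some HG) [::] ::
  [seq horn (Some (HS j)) [:: HA (a j) (g j)] | j <- enum J].
pose s1 := [seq horn (Some (HA c (t c))) [::] | c <- enum C].
have us0 : uniq s0.
  rewrite !cons_uniq in_cons negb_or map_inj_uniq ?enum_uniq; last by move=> j j' /hinj[[]].
  rewrite andbT -andbA; apply/and3P; split.
  - by apply/eqP=> /hinj[].
  - by apply/mapP=> -[j _ /hinj[]].
  - by apply/mapP=> -[j _ /hinj[]].
have us1 : uniq s1.
  by rewrite map_inj_uniq ?enum_uniq // => c c' /hinj[[]].
have ps0 D : D \in s0 -> [\/ D = goal1, D = horn (Some HG) [::] |
     exists j, D = horn (Some (HS j)) [:: HA (a j) (g j)]].
  rewrite !in_cons => /or3P[/eqP->|/eqP->|/mapP[j _ ->]]; first by constructor 1.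
    by constructor 2.
  by constructor 3; exists j.
have disj c h : horn (Some (HA c h)) [::] \notin s0.
  by apply/negP=> /ps0[/hinj[]|/hinj[]|[j /hinj[]]].
have us : uniq (s0 ++ s1).
  rewrite cat_uniq us0 us1 andbT; apply/hasPn => D /mapP[c _ ->]; exact: disj.
have sub : {subset s0 ++ s1 <= leafb P}.
  move=> D; rewrite mem_cat => /orP[/ps0[->|->|[j ->]]|/mapP[c _ ->]] //.
    by case: (Ha j).
  by have [_ _] := Ha (f c); rewrite af.
have shape D : D \in s0 ++ s1 -> D = goal1 \/ exists u n, D = horn (Some u) n /\
       (if u is inr y then False else True).
  rewrite mem_cat => /orP[/ps0[->|->|[j ->]]|/mapP[c _ ->]]; first by left.
  - by right; exists HG, [::].
  - by right; exists (HS j), [:: HA (a j) (g j)].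
  - by right; exists (HA c (t c)), [::].
have sz : size (s0 ++ s1) = k.+2.
  by rewrite size_cat /= !size_map -?enumT -!cardE.
have [/forallP sel|] := boolP [forall j, g j == t (a j)].
  exists (s0 ++ s1); split=> //; first by rewrite sz.
  by left; exists t => j; exists (a j); case: (Ha j); rewrite (eqP (sel j)).
case/forallPn=> j nj; exists (horn (Some (HA (a j) (g j))) [::] :: s0 ++ s1); split.
- rewrite cons_uniq us andbT mem_cat negb_or disj; apply/mapP=> -[c _ /hinj[] //].
  by case=> E1 E2; case/eqP: nj; rewrite E2 E1.
- move=> D; rewrite in_cons => /orP[/eqP->|/sub //].
  by case: (Ha j).
- move=> D; rewrite in_cons => /orP[/eqP->|/shape //].
  by right; exists (HA (a j) (g j)), [::].
- by rewrite -[size _]/(size (s0 ++ s1)).+1 sz.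
- by right; rewrite -[size _]/(size (s0 ++ s1)).+1 sz.
Qed.

Lemma contains_leaves P D1 D2 : is_res_proof F P ->
  contains_res_of_leaves P D1 D2 -> leafb P D1 /\ leafb P D2.
Proof.
case=> _ val _ _ [m [i [j [x [D [lt E H]]]]]].
have := val m lt; rewrite /valid_node E => -[li lj _ _ _].
by case: H => -[Ei Ej]; split; apply/leafbP; [exists i|exists j|exists j|exists i] => //; lia.
Qed.

Lemma goal1_F : goal1 \in F. Proof. by apply/FE; left. Qed.
Lemma goal2_F : goal2 \in F. Proof. by apply/FE; do 4!right; left. Qed.
Lemma HG_F : horn (Some HG) [::] \in F. Proof. by apply/FE; right; left. Qed.
Lemma HY_F y : horn (Some (HY y)) [::] \in F.
Proof. by apply/FE; do 5!right; exists y. Qed.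

(** The decoy has size 2k + 3, the same as the refutation given by a selection. A refutation using
    the unit [HG] exceeds this size if it contains all decoy leaves, which with [HG] are k + 3
    leaves, and also if no selection exists, by [leaves1]. *)
Theorem orp_selects : #|Y| = k.+1 ->
  ORP_instance F (horn (Some HG) [::]) goal1 <-> exists t, selects t.
Proof.
move=> cY; split.
  case=> _ _ [P [prf reg min cont]].
  have [lG l1] := contains_leaves prf cont.
  have /card_gt0P[y0 _] : 0 < #|Y| by rewrite cY.
  have [Q [qprf qreg qs _]] := proof2 y0.
  have := min Q qprf qreg; rewrite /proof_size qs cY => leP.
  have [[l2 ly]|[_ _ [a [g Ha]]]] := leaves_cases prf.
    have [s [us sub sz shape]] := leaves2 l2 ly.
    have nG : horn (Some HG) [::] \notin s.
      by apply/negP=> /shape[/hinj[]//|[y /hinj[]//]].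
    have := @leaves_bound F P (horn (Some HG) [::] :: s) prf.
    rewrite cons_uniq us nG /= sz cY => /(_ isT) => B.
    have : (k.+3).*2 <= (size P).+1.
      by apply: B => D; rewrite in_cons => /orP[/eqP->|/sub].
    by lia.
  have [s [us sub _ _ [//|sz]]] := leaves1 l1 lG Ha.
  by have B := leaves_bound prf us sub; exfalso; lia.
case=> t st; split; [exact: HG_F | exact: goal1_F |].
have [P [prf reg sz cont]] := proof1 st.
exists P; split=> // Q qprf qreg; rewrite /proof_size sz.
have [[l2 ly]|[l1 lG [a [g Ha]]]] := leaves_cases qprf.
  have [s [us sub szs shape]] := leaves2 l2 ly.
  by have := leaves_bound qprf us sub; rewrite szs cY; lia.
have [s [us sub _ szs _]] := leaves1 l1 lG Ha.
by have := leaves_bound qprf us sub; lia.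
Qed.

(** The decoy now has size 2k + 5. A selection gives size 2k + 3, which no refutation with the leaf
    [HY y0] attains: it has at least k + 3 leaves. Without a selection every refutation has that
    many leaves, and the decoy is optimal. *)
Theorem orp_not_selects y0 : #|Y| = k.+2 ->
  ORP_instance F (horn (Some (HY y0)) [::]) goal2 <-> ~ exists t, selects t.
Proof.
move=> cY; split.
  case=> _ _ [P [prf reg min cont]] [t st].
  have [lY l2] := contains_leaves prf cont.
  have [Q [qprf qreg qs _]] := proof1 st.
  have := min Q qprf qreg; rewrite /proof_size qs => leP.
  have [[_ ly]|[l1 lG [a [g Ha]]]] := leaves_cases prf.
    have [s [us sub sz shape]] := leaves2 l2 ly.
    by have := leaves_bound prf us sub; rewrite sz cY; lia.
  have [s [us sub shape sz _]] := leaves1 l1 lG Ha.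
  have nY : horn (Some (HY y0)) [::] \notin s.
    by apply/negP=> /shape[/hinj[]//|[u [n [/hinj[]// [<-]]]]].
  have := @leaves_bound F P (horn (Some (HY y0)) [::] :: s) prf.
  rewrite cons_uniq us nY /= => /(_ isT) => B.
  have : (size s).+1.*2 <= (size P).+1.
    by apply: B => D; rewrite in_cons => /orP[/eqP->|/sub].
  by lia.
move=> ns; split; [exact: HY_F | exact: goal2_F |].
have [P [prf reg sz cont]] := proof2 y0.
exists P; split=> // Q qprf qreg; rewrite /proof_size sz cY.
have [[l2 ly]|[l1 lG [a [g Ha]]]] := leaves_cases qprf.
  have [s [us sub szs shape]] := leaves2 l2 ly.
  by have := leaves_bound qprf us sub; rewrite szs cY; lia.
have [s [us sub _ _ [//|szs]]] := leaves1 l1 lG Ha.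
by have := leaves_bound qprf us sub; lia.
Qed.

End Selection.

(** * Tableaux *)

(* Template symbols: [(false, b)] is the bit b, [(true, false)] a cell to be
   guessed and [(true, true)] a blank cell. *)
Definition tsym : finType := (bool * bool)%type.
Definition tbit (b : bool) : tsym := (false, b).
Definition tfree : tsym := (true, false).
Definition tpad : tsym := (true, true).

Section Tiling.
Variables (G : finType) (U : bool -> bool -> bool -> tsym -> G -> bool).
Variables (W : G -> G -> G -> G -> bool).

Definition quad : finType := (G * G * G * G)%type.

Definition tiling (x : seq tsym) (tau : nat -> nat -> G) : Prop :=
  (forall t i, t < size x -> i < size x ->
     U (t == 0) (t.+1 == size x) (i == 0) (nth tpad x i) (tau t i)) /\
  (forall t i, t.+1 < size x -> i.+1 < size x ->
     W (tau t i) (tau t i.+1) (tau t.+1 i) (tau t.+1 i.+1)).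

(** When the window is allowed or the block sticks out of the square, the goal is served by any
    content of its own cell; the goals then form a full product, which is easy to enumerate by
    loops. *)
Definition opt_at (x : seq tsym) (t i : nat) (o : option quad) (t' i' : nat) (g : G) :=
  match o with
  | None => [&& t' == t, i' == i &
              U (t == 0) (t.+1 == size x) (i == 0) (nth tpad x i) g]
  | Some (a, b, c, d) =>
      if [|| W a b c d, t.+1 == size x | i.+1 == size x] then (t' == t) && (i' == i)
      else [|| [&& t' == t, i' == i & g != a], [&& t' == t, i' == i.+1 & g != b],
               [&& t' == t.+1, i' == i & g != c] | [&& t' == t.+1, i' == i.+1 & g != d]]
  end.

Definition opt (x : seq tsym) (j : 'I_(size x) * 'I_(size x) * option quad)
    (c : 'I_(size x) * 'I_(size x)) (g : G) :=
  opt_at x j.1.1 j.1.2 j.2 c.1 c.2 g.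

Lemma opt_local x c : exists j, forall c' g, @opt x j c' g -> c' = c.
Proof.
case: c => t i; exists (t, i, None) => -[t' i'] g /and3P[/= /eqP E /eqP E' _].
by congr pair; apply: val_inj.
Qed.

Lemma selects_tiling x : 0 < size x -> (exists t, selects (@opt x) t) <-> exists tau, tiling x tau.
Proof.
move=> x_gt0; split=> [[s Hs]|[tau [HU HW]]]; last first.
  exists (fun c : 'I_(size x) * 'I_(size x) => tau c.1 c.2) => -[[t i] [[[[a b] c] d]|]]; last first.
    by exists (t, i); apply/and3P; split=> //; exact: HU.
  rewrite /opt /=.
  case: [|| W a b c d, t.+1 == size x | i.+1 == size x] / boolP.
    by exists (t, i); rewrite /= !eqxx.
  rewrite !negb_or => /and3P[nW nt ni].
  have lt : t.+1 < size x by have := ltn_ord t; lia.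
  have li : i.+1 < size x by have := ltn_ord i; lia.
  have := HW _ _ lt li.
  have [->|na] := eqVneq (tau t i) a; last by exists (t, i); rewrite /= !eqxx na.
  have [->|nb] := eqVneq (tau t i.+1) b.
    2: by exists (t, Ordinal li); rewrite /= !eqxx nb orbT.
  have [->|nc] := eqVneq (tau t.+1 i) c.
    2: by exists (Ordinal lt, i); rewrite /= !eqxx nc !orbT.
  have [->|nd] := eqVneq (tau t.+1 i.+1) d.
    2: by exists (Ordinal lt, Ordinal li); rewrite /= !eqxx nd !orbT.
  by rewrite (negPf nW).
case: x x_gt0 s Hs => // x0 x _ s Hs.
pose tau t i := s (inord t, inord i).
exists tau; split=> t i lt li.
  have [[t' i'] /and3P[/= /eqP E /eqP E' H]] := Hs (inord t, inord i, None).
  rewrite !inordK // in E E' H; rewrite /tau.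
  have -> : (inord t, inord i) = (t', i') by congr pair; apply: val_inj; rewrite /= inordK.
  by [].
(* Were the observed window forbidden, the goal for this very window would require one of its
   corners to differ from itself. *)
set w := (tau t i, tau t i.+1, tau t.+1 i, tau t.+1 i.+1).
apply/negPn/negP => nW.
have [[t' i']] := Hs (inord t, inord i, Some w).
rewrite /= in lt li; have lt' := ltnW lt; have li' := ltnW li.
have sE k l (t1 i1 : 'I_(size x).+1) : k < (size x).+1 -> l < (size x).+1 ->
    t1 = k :> nat -> i1 = l :> nat -> s (t1, i1) = tau k l.
  by move=> lk ll E E'; rewrite /tau; congr (s (_, _)); apply: val_inj; rewrite /= inordK.
rewrite /opt /= !inordK // (negPf nW) (ltn_eqF lt) (ltn_eqF li) /=.
by case/or4P => /and3P[/eqP E /eqP E']; rewrite (sE _ _ _ _ _ _ E E') // eqxx.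
Qed.

End Tiling.

(** * Accepting runs as tilings *)

Section Tableau.
Variable M : TM.
Notation Q := (tm_state M).
Notation A := (tm_sym M).
Notation blank := (tm_blank M).

(* State, head symbol, left and right tape symbols, first column flag, and a
   flag telling that the initial contents stops before this column. The tape is
   seen from the head: column [i] holds the symbols at distance [i] to the right
   (0 being the head) and [i + 1] to the left. *)
Definition gamma : finType := (Q * A * A * A * bool * bool)%type.
Definition gq (g : gamma) := g.1.1.1.1.1.
Definition gh (g : gamma) := g.1.1.1.1.2.
Definition gl (g : gamma) := g.1.1.1.2.
Definition gr (g : gamma) := g.1.1.2.
Definition gf (g : gamma) := g.1.2.
Definition ge (g : gamma) := g.2.

Definition effect (q : Q) (h : A) :=
  if tm_halt M q then (q, h, MStay) else tm_delta M q h.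

(** Relative to the head, a move shifts the two half-tapes by one column in opposite directions, and
    the first column passes a symbol from one half to the other. State and head symbol are copied
    along each row, so that every block knows the transition. *)
Definition win (a b c d : gamma) : bool :=
  let: (q, s, m) := effect (gq a) (gh a) in
  let w := if gf a then s else gr a in
  [&& gh b == gh a, gh d == gh c, gq c == q, gq d == q, ge a ==> ge b &
    match m with
    | MRight => [&& gr c == gr b, gl d == gl a & gf a ==> (gl c == s)]
    | MLeft => [&& gr d == w, gl c == gl b & gf a ==> (gr c == gl a)]
    | MStay => (gr c == w) && (gl c == gl a)
    end].

(** A free cell holds a bit or, with the flag [ge] raised, a blank; [win] propagates the flag to the
    right, so the guessed bits are contiguous. Padding always has the flag raised. *)
Definition fits (d : tsym) (g : gamma) : bool :=
  if ~~ d.1 then (gr g == tm_in M d.2) && ~~ ge g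
  else if ge g then gr g == blank
  else ~~ d.2 && ((gr g == tm_in M false) || (gr g == tm_in M true)).

Definition unary (tf tl jf : bool) (d : tsym) (g : gamma) : bool :=
  [&& gf g == jf, jf ==> (gr g == gh g), tl ==> tm_accept M (gq g) &
    tf ==> [&& gq g == tm_start M, gl g == blank & fits d g]].

(** Reading with the default [blank] turns the finite lists into infinite half-tapes, for which each
    move is a plain shift. *)
Definition cR (c : config M) i := let: (_, _, h, r) := c in nth blank (h :: r) i.
Definition cL (c : config M) i := let: (_, l, _, _) := c in nth blank l i.

Lemma step_spec (c : config M) :
  let c' := tm_step c in
  let: (q, s, m) := effect (cstate c) (cR c 0) in
  let w i := if i == 0 then s else cR c i in
  cstate c' = q /\
  match m with
  | MRight => (forall i, cR c' i = w i.+1) /\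
              (forall i, cL c' i = if i is i'.+1 then cL c i' else s)
  | MLeft => (forall i, cR c' i = if i is i'.+1 then w i' else cL c 0) /\
             (forall i, cL c' i = cL c i.+1)
  | MStay => (forall i, cR c' i = w i) /\ (forall i, cL c' i = cL c i)
  end.
Proof.
case: c => [[[q l] h] r]; rewrite /effect /=; case: ifP => /= H.
  by split=> //; split=> // -[].
case: (tm_delta M q h) => [[q' s] []] /=.
- case: l => [|a l]; split=> //; split=> [[|[|i]]|[|i]] //=; rewrite ?nth_nil //.
- by case: r => [|a r]; split=> //; split=> [[|i]|[|i]] //=; rewrite ?nth_nil.
- by split=> //; split=> // -[].
Qed.

Lemma cR_init z i : cR (init_config M z) i = nth blank (map (tm_in M) z) i.
Proof. by rewrite /init_config; case: z => [|b z]; case: i => [|i] //=; rewrite nth_nil. Qed.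

Lemma cL_init z i : cL (init_config M z) i = blank.
Proof. by rewrite /init_config; case: z => [|b z] /=; rewrite nth_nil. Qed.

Lemma cstate_init z : cstate (init_config M z) = tm_start M.
Proof. by rewrite /init_config; case: z. Qed.

Section Template.
Variables (z0 : seq bool) (p r : nat).
Hypotheses (z0_gt0 : 0 < size z0) (r_gt0 : 0 < r).
Let x : seq tsym := map tbit z0 ++ nseq p tfree ++ nseq r tpad.
Let sx : size x = size z0 + p + r.
Proof. by rewrite !size_cat size_map !size_nseq addnA. Qed.

Let nthx i : nth tpad x i = if i < size z0 then tbit (nth false z0 i) else
  if i < size z0 + p then tfree else tpad.
Proof.
rewrite nth_cat size_map; case: ltnP => [lt|le]; first by rewrite (nth_map false).
rewrite nth_cat size_nseq ltn_subLR //; case: ltnP => lt; rewrite nth_nseq.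
  by rewrite ifT //; lia.
by case: ifP.
Qed.

Lemma fill_free (f : nat -> A) (e : nat -> bool) n :
  (forall i, i < n -> if e i then f i = blank
                      else f i = tm_in M false \/ f i = tm_in M true) ->
  (forall i, i.+1 < n -> e i -> e i.+1) ->
  exists2 y, size y <= n & forall i, i < n -> f i = nth blank (map (tm_in M) y) i.
Proof.
elim: n f e => [|n IH] f e Hf He; first by exists [::].
case e0 : (e 0).
  exists [::] => // i lt; rewrite nth_nil.
  have ei : e i by elim: i lt => // i IHi lt; apply: He => //; apply: IHi; lia.
  by have := Hf i lt; rewrite ei.
have [|i lt|y sy Hy] := IH (fun i => f i.+1) (fun i => e i.+1).
- by move=> i lt; apply: Hf.
- by apply: He.
have [b Eb] : exists b, f 0 = tm_in M b.
  by have := Hf 0 isT; rewrite e0 => -[]; [exists false|exists true].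
by exists (b :: y) => // -[|i] //= lt; exact: Hy.
Qed.

(** The square has one row per time from 0 to [(size x).-1]; the free cells of row 0 spell [y], and
    acceptance is read from the state in the last row. *)
Theorem tableau : (exists tau, tiling unary win x tau) <->
  exists2 y, size y <= p & tm_accept M (cstate (tm_run M (z0 ++ y) (size x).-1)).
Proof.
have gt1 : 1 < size x by rewrite sx; lia.
split=> [[tau [HU HW]]|[y sy acc]].
  have rowU i : i < size x -> [/\ gq (tau 0 i) = tm_start M, gl (tau 0 i) = blank &
      fits (nth tpad x i) (tau 0 i)].
    move=> lt; have := HU 0 i _ lt; rewrite eqxx => /(_ ltac:(lia)) /and4P[_ _ _ /=].
    by case/and3P=> /eqP ? /eqP ? ?.
  have eE t i : t.+1 < size x -> i.+1 < size x -> 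
     [/\ gh (tau t i.+1) = gh (tau t i), gh (tau t.+1 i.+1) = gh (tau t.+1 i) &
       ge (tau t i) -> ge (tau t i.+1)].
    move=> lt li; have := HW _ _ lt li; rewrite /win.
    case: effect => [[q s] m] /and5P[/eqP ? /eqP ? _ _ /andP[/implyP ? _]].
    by split.
  (* The witness consists of the bits in the free cells before the first raised flag. *)
  have [|i lt|y sy Hy] := @fill_free (fun i => gr (tau 0 (size z0 + i)))
     (fun i => ge (tau 0 (size z0 + i))) p.
  - move=> i lt; have [|_ _] := rowU (size z0 + i); first by rewrite sx; lia.
    rewrite nthx ifF; last by lia.
    rewrite ifT; last by lia.
    rewrite /fits /=; case: ge => [/eqP //|].
    by case/orP=> /eqP; [left | right].
  - rewrite addnS; case: (eE 0 (size z0 + i)) => //; rewrite sx; lia.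
  exists y => //.
  set z := z0 ++ y; pose c t := tm_run M z t.
  have row0 i : i < size x -> gr (tau 0 i) = nth blank (map (tm_in M) z) i.
    move=> lt; have [_ _] := rowU i lt; rewrite nthx map_cat nth_cat size_map.
    case: ltnP => [lt0|ge0]; first by rewrite (nth_map false) // => /andP[/eqP].
    case: ltnP => lt1.
      by move=> _; rewrite -Hy ?subnKC //; lia.
    rewrite /fits /= nth_default ?size_map; last by lia.
    by case: ge => // /eqP.
  have ghE t i : t < size x -> i < size x -> gh (tau t i) = gh (tau t 0).
    move=> lt; elim: i => // i IHi li; rewrite -IHi; last by lia.
    case: t lt {IHi} => [|t] lt; first by case: (eE 0 i).
    by case: (eE t i).
  (* Nothing constrains the last column, so its errors propagate: the symbols are
     only known to be right above the antidiagonal. *)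
  have main t : t < size x -> forall i, i < size x ->
     gq (tau t i) = cstate (c t) /\
     (i + t < size x -> gr (tau t i) = cR (c t) i /\ gl (tau t i) = cL (c t) i).
    elim: t => [|t IHt] lt i li.
      have [-> -> _] := rowU i li.
      by rewrite /c /tm_run /= cstate_init cR_init cL_init row0.
    have {}IHt := IHt (ltnW lt).
    have head j : j < size x -> gh (tau t j) = cR (c t) 0.
      move=> lj; rewrite ghE //; last by lia.
      have := HU t 0 _ _; rewrite eqxx => /(_ ltac:(lia) ltac:(lia)) /and4P[_ /eqP <- _ _].
      by have [_ H0] := IHt 0 ltac:(lia); have [] := H0 ltac:(lia).
    have fst j : j < size x -> gf (tau t j) = (j == 0).
      by move=> lj; have := HU t j _ lj => /(_ ltac:(lia)) /and4P[/eqP].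
    have -> : c t.+1 = tm_step (c t) by [].
    have := step_spec (c t).
    case E: effect => [[q s] m] [-> Hm].
    have wE j : j.+1 < size x -> [/\ gq (tau t.+1 j) = q, gq (tau t.+1 j.+1) = q &
       let w := if j == 0 then s else gr (tau t j) in
       match m with
       | MRight => [/\ gr (tau t.+1 j) = gr (tau t j.+1), gl (tau t.+1 j.+1) = gl (tau t j) &
             j = 0 -> gl (tau t.+1 j) = s]
       | MLeft => [/\ gr (tau t.+1 j.+1) = w, gl (tau t.+1 j) = gl (tau t j.+1) &
             j = 0 -> gr (tau t.+1 j) = gl (tau t j)]
       | MStay => gr (tau t.+1 j) = w /\ gl (tau t.+1 j) = gl (tau t j)
       end].
      move=> lj; have := HW _ _ lt lj; rewrite /win.
      have [-> _] := IHt j ltac:(lia); rewrite head; last by lia.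
      rewrite E fst; last by lia.
      case/and5P=> _ _ /eqP-> /eqP-> /andP[_ H]; split=> //; move: H.
      case: (m) => [/and3P[/eqP-> /eqP-> /implyP h]|/and3P[/eqP-> /eqP-> /implyP h]|/andP[/eqP-> /eqP->]] //.
        by split=> // j0; apply/eqP/h; rewrite j0.
      by split=> // j0; apply/eqP/h; rewrite j0.
    split.
      case: i li => [|i] li; first by case: (wE 0).
      by case: (wE i).
    move=> lit.
    have cone j : j <= i.+1 -> gr (tau t j) = cR (c t) j /\ gl (tau t j) = cL (c t) j.
      by move=> le; apply: (IHt j _).2; lia.
    have [_ _] := wE i ltac:(lia).
    have [c1 c2] := cone i ltac:(lia); have [c3 c4] := cone i.+1 ltac:(lia).
    case: m E Hm wE => E [-> ->] wE.
    + move=> [w1 w2 w3]; rewrite w2 c4; split=> //.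
      case: i li lit cone c1 c2 c3 c4 w1 w2 w3 => [|i] li lit cone c1 c2 c3 c4 w1 w2 w3.
        by rewrite w3 // c2.
      have [_ _ [-> _ _]] := wE i ltac:(lia).
      by have [-> _] := cone i ltac:(lia).
    + move=> [w1 w2 w3]; rewrite w1 c3; split=> //.
      case: i li lit cone c1 c2 c3 c4 w1 w2 w3 => [|i] li lit cone c1 c2 c3 c4 w1 w2 w3.
        by rewrite w3.
      have [_ _ [_ -> _]] := wE i ltac:(lia).
      by have [_ ->] := cone i ltac:(lia).
    + by move=> [-> ->]; rewrite c1 c2.
  have := HU (size x).-1 0 ltac:(lia) ltac:(lia).
  case/and4P=> _ _ /implyP H _; have := H ltac:(lia).
  by have [-> _] := main (size x).-1 ltac:(lia) 0 ltac:(lia).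
set z := z0 ++ y; pose c t := tm_run M z t.
exists (fun t i => (cstate (c t), cR (c t) 0, cL (c t) i, cR (c t) i, i == 0, size z <= i)).
split=> t i lt li.
  rewrite /unary /gf /gr /gh /gq /gl /= eqxx /=; apply/and3P; split.
  - by apply/implyP=> /eqP->.
  - apply/implyP=> /eqP E; move: acc; rewrite -E; exact.
  apply/implyP=> /eqP->; rewrite /c /tm_run /= cstate_init cL_init !eqxx /= nthx /fits /ge /gr /= cR_init.
  have sz : size z = size z0 + size y by rewrite size_cat.
  rewrite map_cat nth_cat size_map.
  case: ltnP => [lt0|ge0] /=; first by rewrite (nth_map false) // eqxx /= -ltnNge sz; lia.
  case: (leqP (size z) i) => le1.
    rewrite nth_default ?size_map; last by lia.
    by case: (i < _ + p); rewrite /= eqxx.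
  rewrite (_ : i < size z0 + p) /=; last by lia.
  rewrite (nth_map false); last by lia.
  by case: nth; rewrite eqxx ?orbT.
rewrite /win /gf /gr /gh /gq /gl /ge /=.
have := step_spec (c t); rewrite -[tm_step (c t)]/(c t.+1).
case: effect => [[q s] m] [-> Hm]; rewrite !eqxx /=; apply/andP; split; first by lia.
case: m Hm => [] [HR HL]; rewrite !HR !HL ?eqxx //=.
- by case: i li => [|i] li; rewrite ?eqxx.
- by case: i li => [|i] li; rewrite ?eqxx.
Qed.

End Template.
End Tableau.

(** * Programs for the reduction *)

Section Programs.
Variable K : nat.
Notation prog := (prog tsym K.+4.+1).
Notation env := (env K.+4.+1).
Notation cell := (cell tsym K.+4.+1).

(** Five pebbles always exist: 0 and 1 mark the position of a goal or unit, 2 and 3 that of a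
    serving cell, and 4 runs along an indicator string. The others leave room for the deep nests of
    [poly_prog]. *)
Definition pb (i : nat) : 'I_K.+4.+1 := inord i.

Lemma pb_eq i j : i < K.+4.+1 -> j < K.+4.+1 -> (pb i == pb j) = (i == j).
Proof. by move=> li lj; rewrite -val_eqE /= !inordK. Qed.

Definition emits (s : seq bool) : prog :=
  foldr (fun b c => Seq (Emit _ (tbit b)) c) (Skip _ _) s.
Definition pseq (cs : seq prog) : prog := foldr (@Seq _ _) (Skip _ _) cs.

Lemma wf_emits A s : wf A (emits s).
Proof. by elim: s => //= b s ->. Qed.

Lemma wf_pseq (T : Type) A (f : T -> prog) s : (forall a, wf A (f a)) ->
  wf A (pseq (map f s)).
Proof. by move=> H; elim: s => //= a s ->; rewrite H. Qed.

Fixpoint nest (n : nat) (d : tsym) : prog :=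
  if n is m.+1 then For (pb m) (nest m d) else Emit _ d.
Definition poly_prog (c : nat) (d : tsym) : prog :=
  Seq (pseq (nseq c (nest c d))) (pseq (nseq c (Emit _ d))).

Lemma wf_nest n d (A : seq 'I_K.+4.+1) : n <= K.+4.+1 -> (forall m, m < n -> pb m \notin A) ->
  wf A (nest n d).
Proof.
elim: n A => //= n IH A le H; rewrite H //=; apply: IH => [|m lt]; first by lia.
by rewrite inE pb_eq ?(negPf (H _ _)) ?orbF; try lia.
Qed.

Lemma eval_nest x n d e : eval x (nest n d) e = nseq (size x ^ n) d.
Proof.
elim: n e => [|n IH] e //=.
under eq_map do rewrite IH.
rewrite expnS; move: (size x ^ n) => a; elim: (size x) {IH} 0 => //= m IH k.
by rewrite IH mulSn nseqD.
Qed.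

Lemma eval_pseq_nseq x n c e d k : (eval x c e = nseq k d) ->
  eval x (pseq (nseq n c)) e = nseq (n * k) d.
Proof. by move=> E; elim: n => //= n ->; rewrite E mulSn nseqD. Qed.

Lemma eval_poly x c d e : eval x (poly_prog c d) e = nseq (poly_bound c (size x)) d.
Proof.
rewrite /= (eval_pseq_nseq _ (eval_nest x c d e)).
by rewrite (@eval_pseq_nseq x c (Emit _ d) e d 1) // muln1 nseqD.
Qed.

Lemma wf_poly c d : c <= K.+4.+1 -> wf [::] (poly_prog c d).
Proof.
have H n a : wf [::] a -> wf [::] (pseq (nseq n a)) by move=> wa; elim: n => //= n ->; rewrite wa.
by move=> le; rewrite /= !H // wf_nest.
Qed.

Definition is_at (p : 'I_K.+4.+1) (P : pred tsym) : option cell -> cell -> bool :=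
  fun _ c => c.2 p && P c.1.
Definition same (p q : 'I_K.+4.+1) : option cell -> cell -> bool :=
  fun _ c => c.2 p && c.2 q.
Definition next_to (p q : 'I_K.+4.+1) : option cell -> cell -> bool :=
  fun prev c => if prev is Some c' then c'.2 p && c.2 q else false.
Definition is_first (p : 'I_K.+4.+1) : option cell -> cell -> bool :=
  fun prev c => if prev is Some _ then false else c.2 p.
(** A test only looks to the left, so a position is recognised as inner when the sweep reaches its
    right neighbour. *)
Definition not_last (p : 'I_K.+4.+1) : option cell -> cell -> bool :=
  fun prev c => if prev is Some c' then c'.2 p else false.

Section Tests.
Variables (x : seq tsym) (e : env).
Let N := size x.

Definition cell_at (i : nat) : cell := (nth tpad x i, [ffun p => e p == Some i]).

Lemma holdsP (r : option cell -> cell -> bool) : reflect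
  (exists2 i, i < N & r (if i is j.+1 then Some (cell_at j) else None) (cell_at i))
  (holds None r (cells 0 x e)).
Proof.
have H y k prev : holds prev r (cells k y e) =
   has (fun i => r (if i is j.+1 then Some (nth tpad y j, [ffun p => e p == Some (k + j)]) else prev)
                   (nth tpad y i, [ffun p => e p == Some (k + i)])) (iota 0 (size y)).
  elim: y k prev => //= d y IH k prev; rewrite addn0; congr orb.
  rewrite IH -[1]addn0 iotaDl has_map; apply: eq_has => i /=.
  by rewrite !addSnnS; case: i => [|i] /=; rewrite ?addn0 // addSnnS.
rewrite H; apply: (iffP hasP) => -[i]; first by rewrite mem_iota => lt h; exists i.
by move=> lt h; exists i; rewrite ?mem_iota.
Qed.

Lemma holds_same p q i j : e p = Some i -> e q = Some j -> i < N ->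
  holds None (same p q) (cells 0 x e) = (i == j).
Proof.
move=> ep eq lt; apply/holdsP/eqP => [[k _]|Eij].
  by rewrite /same !ffunE ep eq => /andP[/eqP[->] /eqP[]].
by exists i => //; rewrite /same !ffunE ep eq Eij !eqxx.
Qed.

Lemma holds_next p q i j : e p = Some i -> e q = Some j -> j < N ->
  holds None (next_to p q) (cells 0 x e) = (j == i.+1).
Proof.
move=> ep eq lt; apply/holdsP/eqP => [[[//|k] _]|Eij].
  by rewrite /next_to !ffunE ep eq => /andP[/eqP[->] /eqP[]].
by exists j; rewrite // Eij /next_to !ffunE ep eq Eij !eqxx.
Qed.

Lemma holds_first p i : e p = Some i -> i < N ->
  holds None (is_first p) (cells 0 x e) = (i == 0).
Proof.
move=> ep lt; apply/holdsP/eqP => [[[|//] _]|Ei].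
  by rewrite /is_first !ffunE ep => /eqP[].
by exists 0; rewrite /is_first ?ffunE ?ep -?Ei.
Qed.

Lemma holds_inner p i : e p = Some i -> i < N ->
  holds None (not_last p) (cells 0 x e) = (i.+1 != N).
Proof.
move=> ep lt; apply/holdsP/idP => [[[//|k] lk]|Ei].
  by rewrite /not_last !ffunE ep => /eqP[->]; rewrite neq_ltn lk.
by exists i.+1; [lia | rewrite /not_last !ffunE ep eqxx].
Qed.

Lemma holds_is_at p P i : e p = Some i -> i < N ->
  holds None (is_at p P) (cells 0 x e) = P (nth tpad x i).
Proof.
move=> ep lt; apply/holdsP/idP => [[k _]|Pi].
  by rewrite /is_at !ffunE ep => /andP[/eqP[->]].
by exists i; rewrite // /is_at !ffunE ep eqxx.
Qed.

End Tests.

(** Writes row 0 of the tableau as a template: the part of [pair_enc] known from the input, free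
    cells for the witness, and padding for the running time. *)
Definition stage1 (c1 c2 : nat) : prog :=
  Seq (For (pb 0) (If (is_at (pb 0) snd) (emits [:: true; true]) (emits [:: false; false])))
  (Seq (emits [:: false; true]) (Seq (poly_prog c1 tfree) (poly_prog c2 tpad))).

Lemma wf_stage1 c1 c2 : c1 <= K.+4.+1 -> c2 <= K.+4.+1 -> wf [::] (stage1 c1 c2).
Proof.
move=> l1 l2; apply/andP; split=> //; apply/andP; split=> //.
by apply/andP; split; exact: wf_poly.
Qed.

Lemma eval_seq x (a b : prog) e : eval x (Seq a b) e = eval x a e ++ eval x b e.
Proof. by []. Qed.

Lemma eval_emits x s e : eval x (emits s) e = map tbit s.
Proof. by elim: s => //= b s ->. Qed.

Lemma eval_stage1 c1 c2 w e : eval (map tbit w) (stage1 c1 c2) e =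
  map tbit (flatten [seq [:: b; b] | b <- w] ++ [:: false; true]) ++
  nseq (poly_bound c1 (size w)) tfree ++ nseq (poly_bound c2 (size w)) tpad.
Proof.
rewrite /stage1 3!eval_seq !eval_poly eval_emits size_map map_cat -!catA; congr (_ ++ _).
rewrite /= size_map map_flatten -map_comp.
have -> : map (map tbit \o fun b => [:: b; b]) w =
   [seq [:: nth tpad (map tbit w) i; nth tpad (map tbit w) i] | i <- iota 0 (size w)].
  apply: (@eq_from_nth _ [::]); rewrite !size_map ?size_iota // => i lt.
  by rewrite (nth_map false) // (nth_map 0) ?size_iota // nth_iota // add0n (nth_map false).
congr flatten; apply/eq_in_map => i; rewrite mem_iota => lt.
rewrite (@holds_is_at _ _ _ _ i) ?size_map //; last by rewrite /upd eqxx.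
by rewrite (nth_map false) //=; case: nth.
Qed.

End Programs.

(** * Printing the formula and the two queried clauses *)

Section Stage2.
Variables (K : nat) (G : finType).
Variables (U : bool -> bool -> bool -> tsym -> G -> bool) (W : G -> G -> G -> G -> bool).
Variable n : nat.
Notation prog := (prog tsym K.+4.+1).
Notation env := (env K.+4.+1).
Notation pb := (pb K).
Notation quad := (quad G).

(* Names are bit strings: the tag in unary, the two coordinates as indicator
   strings over the region, and a final 1 making them canonical. *)
Definition vartag : finType := (unit + option quad + G + option quad + unit + 'I_n)%type.
Definition TG : vartag := inl (inl (inl (inl (inl tt)))).
Definition TS o : vartag := inl (inl (inl (inl (inr o)))).
Definition TA g : vartag := inl (inl (inl (inr g))).
Definition TY o : vartag := inl (inl (inr o)).
Definition TZ : vartag := inl (inr tt).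
Definition TE k : vartag := inr k.

Definition tag_code (a : vartag) : seq bool := nseq (enum_rank a) true ++ [:: false].

Lemma tag_code_inj a a' s s' : tag_code a ++ s = tag_code a' ++ s' -> a = a' /\ s = s'.
Proof.
move=> E; have [Er Es] : enum_rank a = enum_rank a' :> nat /\ s = s'.
  move: E; rewrite /tag_code -!catA; elim: (val (enum_rank a)) (val (enum_rank a')) => [|r IH] [|r'] //=.
    by case.
  by case=> /IH[-> ->].
by split=> //; apply: enum_rank_inj; apply: val_inj.
Qed.

Section Names.
Variable x : seq tsym.
Let N := size x.

Definition onehot (t : nat) : seq bool := [seq q == t | q <- iota 0 N].

Lemma onehot_inj (t t' : 'I_N) s s' : onehot t ++ s = onehot t' ++ s' -> t = t' /\ s = s'.
Proof.
move/eqP; rewrite eqseq_cat ?size_map // => /andP[/eqP E /eqP ->]; split=> //.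
have := congr1 (nth false ^~ t) E; rewrite !(nth_map 0) ?size_iota // !nth_iota // add0n eqxx.
by move/esym/eqP => H; apply: val_inj.
Qed.

Definition posbits (p : option (nat * nat)) : seq bool :=
  if p is Some (t, i) then onehot t ++ onehot i else [::].

Definition rname (a : vartag) p : nat := of_bits (tag_code a ++ posbits p ++ [:: true]).

Lemma bits_rname a p : bits (rname a p) = tag_code a ++ posbits p ++ [:: true].
Proof. by apply: of_bitsK; rewrite !last_cat. Qed.

Lemma rname_inj a a' p p' : rname a p = rname a' p' -> a = a' /\ posbits p = posbits p'.
Proof.
move/(congr1 bits); rewrite !bits_rname => /tag_code_inj[-> E]; split=> //.
by move: E; rewrite !cats1 => /rcons_inj[].
Qed.

Definition position : finType := ('I_N * 'I_N)%type.
Definition goal_index : finType := (position * option quad)%type.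
(** One dummy per goal, one per cell and [n] more: the size of the decoy is thereby tuned through
    [n] alone. *)
Definition dummy_index : finType := (goal_index + position + 'I_n)%type.
Notation hvar := (hvar goal_index position G dummy_index).

Definition vtag (u : hvar) : vartag * option (nat * nat) :=
  match u with
  | inl (inl (inl _)) => (TG, None)
  | inl (inl (inr (t, i, o))) => (TS o, Some (val t, val i))
  | inl (inr (t, i, g)) => (TA g, Some (val t, val i))
  | inr (inl (inl (t, i, o))) => (TY o, Some (val t, val i))
  | inr (inl (inr (t, i))) => (TZ, Some (val t, val i))
  | inr (inr k) => (TE k, None)
  end.

Definition nm (u : hvar) : nat := rname (vtag u).1 (vtag u).2.

Lemma posbits_inj (t i t' i' : 'I_N) :
  posbits (Some (val t, val i)) = posbits (Some (val t', val i')) -> t = t' /\ i = i'.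
Proof.
move=> /onehot_inj[-> E]; split=> //.
by have [] := @onehot_inj i i' [::] [::]; rewrite ?cats0.
Qed.

Lemma nm_inj : injective nm.
Proof.
move=> [[[[]|[[t i] o]]|[[t i] g]]|[[[[t i] o]|[t i]]|k]]
       [[[[]|[[t' i'] o']]|[[t' i'] g']]|[[[[t' i'] o']|[t' i']]|k']];
  move=> /rname_inj[] //=.
- by case=> -> /posbits_inj[-> ->].
- by case=> -> /posbits_inj[-> ->].
- by case=> -> /posbits_inj[-> ->].
- by move=> _ /posbits_inj[-> ->].
- by case=> ->.
Qed.

End Names.

Definition encb (s : seq bool) : seq bool := flatten [seq (if b then sym1 else sym0) | b <- s].

Definition hot (p : 'I_K.+4.+1) : prog :=
  For (pb 4) (If (same p (pb 4)) (emits K sym1) (emits K sym0)).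
Definition posp (pp : option ('I_K.+4.+1 * 'I_K.+4.+1)) : prog :=
  if pp is Some (p, q) then Seq (hot p) (hot q) else Skip _ _.
Definition plit (a : vartag) pp (b : bool) : prog :=
  Seq (emits K (encb (tag_code a))) (Seq (posp pp) (emits K (sym1 ++ if b then symPos else symNeg))).

Lemma wf_plit A a pp b : pb 4 \notin A -> wf A (plit a pp b).
Proof.
move=> nA; apply/and3P; split; try exact: wf_emits.
by case: pp => [[p q]|] //=; rewrite nA.
Qed.

Definition ifc (r : option (cell tsym K.+4.+1) -> cell tsym K.+4.+1 -> bool) (k : bool -> prog) : prog :=
  If r (k true) (k false).

Lemma wf_ifc A r k : (forall b, wf A (k b)) -> wf A (ifc r k).
Proof. by move=> H; rewrite /= !H. Qed.

Definition obits (a1 a2 a3 a4 tf tn jf jn : bool) (d : tsym) (o : option quad) (g : G) :=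
  match o with
  | None => [&& a1, a3 & U tf (~~ tn) jf d g]
  | Some (a, b, c, d) =>
      if [|| W a b c d, ~~ tn | ~~ jn] then a1 && a3
      else [|| [&& a1, a3 & g != a], [&& a1, a4 & g != b],
               [&& a2, a3 & g != c] | [&& a2, a4 & g != d]]
  end.

(** [opt_at] depends on the position only through ten tests. Their answers select a branch, and in
    each branch the table [obits] is evaluated when the program is built. *)
Definition optprog (o : option quad) (g : G) (c : prog) : prog :=
  ifc (same (pb 2) (pb 0)) (fun a1 => ifc (next_to (pb 0) (pb 2)) (fun a2 =>
  ifc (same (pb 3) (pb 1)) (fun a3 => ifc (next_to (pb 1) (pb 3)) (fun a4 =>
  ifc (is_first (pb 0)) (fun tf => ifc (not_last (pb 0)) (fun tn =>
  ifc (is_first (pb 1)) (fun jf => ifc (not_last (pb 1)) (fun jn =>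
  ifc (is_at (pb 1) fst) (fun d1 => ifc (is_at (pb 1) snd) (fun d2 =>
    if obits a1 a2 a3 a4 tf tn jf jn (d1, d2) o g then c else Skip _ _)))))))))).

Lemma wf_optprog A o g c : wf A c -> wf A (optprog o g c).
Proof. by move=> wc; rewrite /optprog; do 10![apply: wf_ifc => ?]; case: ifP. Qed.

Section Semantics.
Variable x : seq tsym.
Let N := size x.
Implicit Types (c : prog) (e : env).

Lemma eval_ifc r k e : eval x (ifc r k) e = eval x (k (holds None r (cells 0 x e))) e.
Proof. by rewrite /=; case: holds. Qed.

Lemma eval_optprog o g c e t i t' i' :
  e (pb 0) = Some t -> e (pb 1) = Some i -> e (pb 2) = Some t' -> e (pb 3) = Some i' ->
  t < N -> i < N -> t' < N -> i' < N ->
  eval x (optprog o g c) e =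
  if opt_at U W x t i o t' i' g then eval x c e else [::].
Proof.
move=> e0 e1 e2 e3 lt li lt' li'; rewrite /optprog !eval_ifc.
rewrite (holds_same e2 e0) // (holds_next e0 e2) // (holds_same e3 e1) // (holds_next e1 e3) //.
rewrite (holds_first e0) // (holds_inner e0) // (holds_first e1) // (holds_inner e1) //.
rewrite !(holds_is_at _ e1) // -surjective_pairing.
rewrite (_ : obits _ _ _ _ _ _ _ _ _ _ _ = opt_at U W x t i o t' i' g).
  by case: opt_at.
by rewrite /obits /opt_at !negbK.
Qed.

Definition ev c e : seq bool := map snd (eval x c e).

Lemma ev_seq a b e : ev (Seq a b) e = ev a e ++ ev b e.
Proof. exact: map_cat. Qed.

Lemma ev_emits s e : ev (emits K s) e = s.
Proof. by rewrite /ev eval_emits -map_comp map_id. Qed.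

Lemma ev_for p a e : ev (For p a) e = flatten [seq ev a (upd e p (Some i)) | i <- iota 0 N].
Proof. by rewrite /ev /= map_flatten -map_comp. Qed.

Lemma ev_if r a b e :
  ev (If r a b) e = if holds None r (cells 0 x e) then ev a e else ev b e.
Proof. by rewrite /ev /=; case: holds. Qed.

Lemma ev_hot p e t : p != pb 4 -> e p = Some t -> t < N -> ev (hot p) e = encb (onehot x t).
Proof.
move=> np ep lt; rewrite ev_for /encb /onehot -map_comp; congr flatten.
apply/eq_in_map => i; rewrite mem_iota => li.
rewrite ev_if (@holds_same _ _ _ _ _ t i) //; last first.
- by rewrite /upd eqxx.
- by rewrite /upd (negPf np).
by rewrite !ev_emits eq_sym.
Qed.

Definition posE (pp : option ('I_K.+4.+1 * 'I_K.+4.+1)) (p : option (nat * nat)) e :=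
  match pp, p with
  | None, None => True
  | Some (p, q), Some (t, i) =>
      [/\ p != pb 4, q != pb 4, e p = Some t, e q = Some i & (t < N) && (i < N)]
  | _, _ => False
  end.

Lemma ev_plit a pp p b e : posE pp p e -> ev (plit a pp b) e = enc_lit (rname x a p, b).
Proof.
move=> H; rewrite /plit !ev_seq !ev_emits /enc_lit bits_rname.
have -> : ev (posp pp) e = encb (posbits x p).
  case: pp p H => [[p1 q1]|] [[t i]|] //= [n1 n2 e1 e2 /andP[lt li]].
  by rewrite ev_seq (ev_hot n1 e1 lt) (ev_hot n2 e2 li) /encb map_cat flatten_cat.
by rewrite /encb !map_cat !flatten_cat -!catA.
Qed.

(** The printed list is specified as a set, so that sequencing becomes disjunction and loops become
    existential quantifiers; [f] is [clause_of] when clauses are printed. *)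
Definition prints (T T' : eqType) (enc : T -> seq bool) (f : T -> T') c e (P : T' -> Prop) :=
  exists ls, ev c e = flatten (map enc ls) /\ forall l, l \in map f ls <-> P l.

Section Prints.
Variables (T T' : eqType) (enc : T -> seq bool) (f : T -> T').
Notation prints_ := (prints enc f).

Lemma prints_ext c e (P P' : T' -> Prop) : (forall l, P l <-> P' l) -> prints_ c e P -> prints_ c e P'.
Proof. by move=> H [ls [E Q]]; exists ls; split=> // l; rewrite Q H. Qed.

Lemma prints_seq a b e P P' : prints_ a e P -> prints_ b e P' ->
  prints_ (Seq a b) e (fun l => P l \/ P' l).
Proof.
move=> [ls [E Q]] [ls' [E' Q']]; exists (ls ++ ls'); split.
  by rewrite ev_seq E E' map_cat flatten_cat.
move=> l; rewrite map_cat mem_cat -Q -Q'; split; [by case/orP; [left|right] | by case=> ->; rewrite ?orbT].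
Qed.

Lemma prints_for p a e (P : 'I_N -> T' -> Prop) :
  (forall i : 'I_N, prints_ a (upd e p (Some (val i))) (P i)) ->
  prints_ (For p a) e (fun l => exists i, P i l).
Proof.
move=> H; rewrite /prints ev_for.
have -> : iota 0 N = map val (enum 'I_N) by rewrite val_enum_ord.
have {}H s : exists ls, flatten [seq ev a (upd e p (Some i)) | i <- map val s] =
     flatten (map enc ls) /\ forall l, l \in map f ls <-> exists2 i, i \in s & P i l.
  elim: s => [|i s [ls [E Q]]]; first by exists [::]; split=> // l; split=> // -[].
  have [ls' [E' Q']] := H i; exists (ls' ++ ls); split.
    by rewrite /= E E' map_cat flatten_cat.
  move=> l; rewrite map_cat mem_cat; split.
    case/orP=> [/Q' h|/Q [j js h]]; first by exists i; rewrite ?mem_head.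
    by exists j; rewrite // inE js orbT.
  case=> j; rewrite inE => /orP[/eqP-> /Q' ->//|js h]; apply/orP; right.
  by apply/Q; exists j.
have [ls [E Q]] := H (enum 'I_N); exists ls; split=> // l; rewrite Q.
by split=> [[i _ h]|[i h]]; exists i; rewrite ?mem_enum.
Qed.

Lemma prints_enum (A : finType) (F : A -> prog) e (P : A -> T' -> Prop) :
  (forall a, prints_ (F a) e (P a)) -> 
  prints_ (pseq (map F (enum A))) e (fun l => exists a, P a l).
Proof.
move=> H; have {}H s : prints_ (pseq (map F s)) e (fun l => exists2 a, a \in s & P a l).
  elim: s => [|a s IH]; first by exists [::]; split=> // l; split=> // -[].
  apply: prints_ext (prints_seq (H a) IH) => l; split.
    case=> [h|[b bs h]]; first by exists a; rewrite ?mem_head.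
    by exists b; rewrite // inE bs orbT.
  by case=> b; rewrite inE => /orP[/eqP->|bs] h; [left|right; exists b].
apply: prints_ext (H _) => l.
by split=> [[i _ h]|[i h]]; exists i; rewrite ?mem_enum.
Qed.

Lemma prints_if (b : bool) a c e P : ev c e = (if b then ev a e else [::]) ->
  prints_ a e P -> prints_ c e (fun l => b /\ P l).
Proof.
move=> E; case: b E => E [ls [El Q]].
  by exists ls; rewrite E; split=> // l; rewrite Q; split=> [|[]].
by exists [::]; rewrite E; split=> // l; split=> // -[].
Qed.

End Prints.

Notation lits := (@prints literal literal enc_lit id).
Notation clauses := (@prints (seq literal) clause enc_clause clause_of).

Definition pclause (c : prog) : prog := Seq c (emits K symEndC).

Lemma prints_lit a pp p b e : posE pp p e ->
  lits (plit a pp b) e (fun l => l = (rname x a p, b)).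
Proof.
move=> H; exists [:: (rname x a p, b)]; rewrite (ev_plit _ _ H) /= cats0; split=> // l.
by rewrite inE; split=> [/eqP|->].
Qed.

Lemma print_clause c e P : lits c e P ->
  exists cl, [/\ ev (pclause c) e = enc_clause cl & forall l, l \in clause_of cl <-> P l].
Proof.
move=> [ls [E Q]]; exists ls; rewrite ev_seq E ev_emits; split=> // l.
by rewrite mem_clause_of -Q map_id.
Qed.

Lemma prints_clause c e P C : lits c e P -> (forall l, l \in C <-> P l) ->
  clauses (pclause c) e (fun D => D = C).
Proof.
move=> /print_clause[cl [E H]] Q; exists [:: cl]; rewrite E /= cats0; split=> // D.
have -> : clause_of cl = C by apply/fsetP=> l; apply/idP/idP => [/H/Q|/Q/H].
by rewrite inE; split=> [/eqP|->].
Qed.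

End Semantics.

Notation pos01 := (Some (pb 0, pb 1)).
Notation pos23 := (Some (pb 2, pb 3)).

Definition pgoal1 : prog := Seq (plit TG None false)
  (For (pb 0) (For (pb 1) (pseq [seq plit (TS o) pos01 false | o <- enum (option quad : finType)]))).
Definition pgoal2 : prog := Seq
  (For (pb 0) (For (pb 1) (Seq (pseq [seq plit (TY o) pos01 false | o <- enum (option quad : finType)])
                               (plit TZ pos01 false))))
  (pseq [seq plit (TE k) None false | k <- enum 'I_n]).
Definition pimp : prog :=
  For (pb 0) (For (pb 1) (For (pb 2) (For (pb 3)
    (pseq [seq pseq [seq optprog o g (pclause (Seq (plit (TS o) pos01 true) (plit (TA g) pos23 false)))
                    | g <- enum G] | o <- enum (option quad : finType)])))).
Definition punits : prog :=
  For (pb 0) (For (pb 1) (pseq [seq pclause (plit (TA g) pos01 true) | g <- enum G])).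
Definition pyunits : prog := Seq
  (For (pb 0) (For (pb 1) (Seq (pseq [seq pclause (plit (TY o) pos01 true) | o <- enum (option quad : finType)])
                               (pclause (plit TZ pos01 true)))))
  (pseq [seq pclause (plit (TE k) None true) | k <- enum 'I_n]).

Definition pformula : prog :=
  Seq (pclause pgoal1) (Seq (pclause (plit TG None true)) (Seq pimp (Seq punits
  (Seq (pclause pgoal2) pyunits)))).

Definition stage2 (c d : prog) : prog :=
  Seq pformula (Seq (emits K symEndF) (Seq (pclause c) (pclause d))).

Lemma wf_nest2 (c : prog) : (forall A, pb 4 \notin A -> wf A c) ->
  wf [::] (For (pb 0) (For (pb 1) c)).
Proof. by move=> H; rewrite /= H !inE !pb_eq. Qed.

Lemma wf_seq A (a b : prog) : wf A a -> wf A b -> wf A (Seq a b).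
Proof. by move=> /= -> ->. Qed.

Lemma wf_goal1 : wf [::] pgoal1.
Proof.
apply: wf_seq; first exact: wf_plit.
by apply: wf_nest2 => A nA; apply: wf_pseq => o; exact: wf_plit.
Qed.

Lemma wf_goal2 : wf [::] pgoal2.
Proof.
apply: wf_seq; last by apply: wf_pseq => k; exact: wf_plit.
apply: wf_nest2 => A nA; apply: wf_seq; last exact: wf_plit.
by apply: wf_pseq => o; exact: wf_plit.
Qed.

Lemma wf_pclause A c : wf A c -> wf A (pclause c).
Proof. by move=> wc; apply: wf_seq => //; exact: wf_emits. Qed.

Lemma wf_imp : wf [::] pimp.
Proof.
rewrite /pimp; set c := pseq _.
suff wc A : pb 4 \notin A -> wf A c by rewrite /= wc !inE !pb_eq.
move=> nA; apply: wf_pseq => o; apply: wf_pseq => g; apply/wf_optprog/wf_pclause.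
by apply: wf_seq; exact: wf_plit.
Qed.

Lemma wf_formula : wf [::] pformula.
Proof.
have wu a A pp : pb 4 \notin A -> wf A (pclause (plit a pp true)).
  by move=> nA; apply/wf_pclause/wf_plit.
apply: wf_seq; first exact/wf_pclause/wf_goal1.
apply: wf_seq; first exact: wu.
apply: wf_seq; first exact: wf_imp.
apply: wf_seq.
  by apply: wf_nest2 => A nA; apply: wf_pseq => g; exact: wu.
apply: wf_seq; first exact/wf_pclause/wf_goal2.
apply: wf_seq; last by apply: wf_pseq => k; exact: wu.
apply: wf_nest2 => A nA; apply: wf_seq; last exact: wu.
by apply: wf_pseq => o; exact: wu.
Qed.

Lemma wf_stage2 c d : wf [::] c -> wf [::] d -> wf [::] (stage2 c d).
Proof.
move=> wc wd; apply: wf_seq; first exact: wf_formula.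
apply: wf_seq; first exact: wf_emits.
by apply: wf_seq; exact: wf_pclause.
Qed.

Section Spec.
Variable x : seq tsym.
Notation N := (size x).
Notation C := (position x).
Notation J := (goal_index x).
Notation Y := (dummy_index x).
Notation nm := (@nm x).
Notation lits := (@prints x literal literal enc_lit id).
Notation clauses := (@prints x (seq literal) clause enc_clause clause_of).
Notation HG := (HG J C G Y).
Notation HS := (@HS J C G Y).
Notation HA := (@HA J C G Y).
Notation HY := (@HY J C G Y).

Lemma mem_horn (p : option (hvar J C G Y)) ns l : l \in horn nm p ns <->
  (exists2 u, p = Some u & l = (nm u, true)) \/ (exists2 u, u \in ns & l = (nm u, false)).
Proof.
rewrite mem_clause_of mem_cat; split.
  case/orP=> /mapP[u us ->]; last by right; exists u.
  by left; exists u => //; case: p us => //= v; rewrite inE => /eqP->.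
by case=> [[u -> ->]|[u us ->]]; apply/orP; [left; rewrite /= inE | right; apply/mapP; exists u].
Qed.

Lemma pos01E e (t i : 'I_N) :
  posE x pos01 (Some (val t, val i)) (upd (upd e (pb 0) (Some (val t))) (pb 1) (Some (val i))).
Proof. by split; rewrite /upd ?pb_eq //= !ltn_ord. Qed.

Lemma pos01E' e (t i t' i' : 'I_N) :
  posE x pos01 (Some (val t, val i)) (upd (upd (upd (upd e (pb 0) (Some (val t))) (pb 1) (Some (val i)))
  (pb 2) (Some (val t'))) (pb 3) (Some (val i'))).
Proof. by split; rewrite /upd ?pb_eq //= !ltn_ord. Qed.

Lemma pos23E e (t i t' i' : 'I_N) :
  posE x pos23 (Some (val t', val i')) (upd (upd (upd (upd e (pb 0) (Some (val t))) (pb 1) (Some (val i)))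
  (pb 2) (Some (val t'))) (pb 3) (Some (val i'))).
Proof. by split; rewrite /upd ?pb_eq //= !ltn_ord. Qed.

Lemma prints_goal1 e : lits pgoal1 e (fun l => l \in goal1 nm).
Proof.
have H := prints_seq (@prints_lit x TG None None false e I)
  (prints_for (p := pb 0) (fun t => prints_for (p := pb 1) (fun i => prints_enum (fun o =>
     prints_lit (TS o) false (pos01E e t i))))).
apply: prints_ext H => l; rewrite /goal1 mem_horn; split.
  case=> [->|[t [i [o ->]]]]; right; first by exists HG; rewrite ?mem_head.
  by exists (HS (t, i, o)); rewrite // inE map_f ?orbT ?mem_enum.
case=> [[]//|[u]]; rewrite inE => /orP[/eqP-> ->|/mapP[[[t i] o] _ -> ->]]; first by left.
by right; exists t, i, o.
Qed.

Lemma prints_goal2 e : lits pgoal2 e (fun l => l \in goal2 nm).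
Proof.
have H := prints_seq 
  (prints_for (p := pb 0) (fun t => prints_for (p := pb 1) (fun i => prints_seq (prints_enum (fun o =>
     prints_lit (TY o) false (pos01E e t i))) (prints_lit TZ false (pos01E e t i)))))
  (prints_enum (fun k => @prints_lit x (TE k) None None false e I)).
apply: prints_ext H => l; rewrite /goal2 mem_horn; split.
  case=> [[t [i [[o ->]|->]]]|[k ->]]; right.
  - by exists (HY (inl (inl (t, i, o)))); rewrite ?map_f ?mem_enum.
  - by exists (HY (inl (inr (t, i)))); rewrite ?map_f ?mem_enum.
  - by exists (HY (inr k)); rewrite ?map_f ?mem_enum.
case=> [[]//|[u /mapP[[[[[t i] o]|[t i]]|k] _ ->] ->]].
- by left; exists t, i; left; exists o.
- by left; exists t, i; right.
- by right; exists k.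
Qed.

Lemma prints_unit a pp p u e : posE x pp p e -> vtag u = (a, p) ->
  lits (plit a pp true) e (fun l => l \in horn nm (Some u) [::]).
Proof.
move=> H E; have Eu : nm u = rname x a p by rewrite -[nm u]/(rname x (vtag u).1 (vtag u).2) E.
apply: prints_ext (prints_lit a true H) => l; rewrite mem_horn -Eu.
by split=> [->|[[_ [<-] ->]|[]//]]; first by left; exists u.
Qed.

Lemma clauses_self c e (D : clause) : lits c e (fun l => l \in D) -> 
  clauses (pclause c) e (fun D' => D' = D).
Proof. by move=> H; apply: prints_clause H _. Qed.

(** The pieces of [pformula] follow the disjuncts of [selection_clause] in order. *)
Lemma prints_formula e : clauses pformula e 
  (selection_clause (opt U W (x := x)) nm).
Proof.
apply: prints_seq; first exact/clauses_self/prints_goal1.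
apply: prints_seq; first exact/clauses_self/(@prints_unit _ None None).
apply: prints_seq.
  apply: (@prints_ext _ _ _ _ _ _ _ (fun D => exists (t i t' i' : 'I_N) o g,
     opt U W (x := x) (t, i, o) (t', i') g /\ D = horn nm (Some (HS (t, i, o))) [:: HA (t', i') g])).
  - move=> D; split=> [[t [i [t' [i' [o [g H]]]]]]|[[[t i] o] [[t' i'] [g H]]]].
      by exists (t, i, o), (t', i'), g.
    by exists t, i, t', i', o, g.
  apply: prints_for => t; apply: prints_for => i; apply: prints_for => t'.
  apply: prints_for => i'; apply: prints_enum => o; apply: prints_enum => g.
  apply: prints_if.
  - rewrite /ev (@eval_optprog x o g _ _ t i t' i') ?ltn_ord //; try by rewrite /upd !pb_eq.
    by rewrite -/(opt U W (t, i, o) (t', i') g); case: opt.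
  - apply: prints_clause (prints_seq (prints_lit _ _ (pos01E' e t i t' i'))
      (prints_lit _ _ (pos23E e t i t' i'))) _ => l.
    rewrite mem_horn; split.
      case=> [[_ [<-] ->]|[u]]; first by left.
      by rewrite inE => /eqP-> ->; right.
    by case=> ->; [left; eexists | right; eexists; first exact: mem_head].
apply: prints_seq.
  apply: prints_ext (prints_for (fun t => prints_for (fun i => prints_enum (fun g =>
    clauses_self (@prints_unit _ _ _ (HA (t, i) g) _ (pos01E e t i) erefl))))) => D.
  by split=> [[t [i [g ->]]]|[[t i] [g ->]]]; [exists (t, i), g | exists t, i, g].
apply: prints_seq; first exact/clauses_self/prints_goal2.
apply: prints_ext (prints_seq (prints_for (fun t => prints_for (fun i => prints_seq (prints_enum (fun o =>
    clauses_self (@prints_unit _ _ _ (HY (inl (inl (t, i, o)))) _ (pos01E e t i) erefl)))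
    (clauses_self (@prints_unit _ _ _ (HY (inl (inr (t, i)))) _ (pos01E e t i) erefl)))))
    (prints_enum (fun k => clauses_self (@prints_unit _ None None (HY (inr k)) _ I erefl)))) => D.
split=> [[[t [i [[o ->]|->]]]|[k ->]]|[[[[[t i] o]|[t i]]|k] ->]].
- by exists (inl (inl (t, i, o))).
- by exists (inl (inr (t, i))).
- by exists (inr k).
- by left; exists t, i; left; exists o.
- by left; exists t, i; right.
- by right; exists k.
Qed.

Lemma lang_stage2 c d e D1 D2 :
  lits c e (fun l => l \in D1) -> lits d e (fun l => l \in D2) ->
  exists F : seq clause, (forall D, D \in F <-> selection_clause (opt U W (x := x)) nm D) /\
    (ORP_lang (map snd (eval x (stage2 c d) e)) <-> ORP_instance F D1 D2).
Proof.
move=> /print_clause[cl1 [E1 H1]] /print_clause[cl2 [E2 H2]].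
have [Fs [EF HF]] := prints_formula e; exists (map clause_of Fs); split=> //.
have -> : map snd (eval x (stage2 c d) e) = enc_instance Fs cl1 cl2.
  by rewrite -/(ev x _ _) /stage2 ev_seq EF ev_seq ev_emits (ev_seq x (pclause c)) E1 E2.
have <- : clause_of cl1 = D1 by apply/fsetP=> l; apply/idP/idP => /H1.
have <- : clause_of cl2 = D2 by apply/fsetP=> l; apply/idP/idP => /H2.
split=> [[Fs' [cl1' [cl2' [/enc_instance_inj[-> -> ->]]]]]|H] //.
by exists Fs, cl1, cl2.
Qed.

End Spec.
End Stage2.

(** * Hardness *)

Lemma leq_poly_bound c m n : m <= n -> poly_bound c m <= poly_bound c n.
Proof.
move=> le; rewrite /poly_bound leq_add2r leq_mul2l.
by case: c => //= c; rewrite leq_exp2r.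
Qed.

Lemma run_halted (M : TM) w m n : tm_halt M (cstate (tm_run M w m)) -> m <= n ->
  tm_run M w n = tm_run M w m.
Proof.
move=> H /subnK <-; elim: (n - m) => // d IH.
rewrite addSn -[LHS]/(tm_step (tm_run M w (d + m))) IH.
by case: (tm_run M w m) H => [[[q l] h] r] /= ->.
Qed.

Section Reduction.
Variables (L : seq bool -> Prop) (V : seq bool -> Prop) (c : nat).
Variables (M : TM) (d : nat).
Hypothesis HM : forall w, exists2 n, n <= poly_bound d (size w) &
    tm_halt M (cstate (tm_run M w n)) /\
    (tm_accept M (cstate (tm_run M w n)) <-> V w).
Hypothesis HL : forall w, L w <->
  exists2 y, size y <= poly_bound c (size w) & V (pair_enc w y).

Definition pair_prefix (w : seq bool) := flatten [seq [:: b; b] | b <- w] ++ [:: false; true].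
Definition template (e : nat) (w : seq bool) : seq tsym :=
  map tbit (pair_prefix w) ++ nseq (poly_bound c (size w)) tfree ++ nseq (poly_bound e (size w)) tpad.

Lemma size_pair_prefix w : size (pair_prefix w) = (size w).*2.+2.
Proof.
rewrite size_cat /= addn2; congr _.+2.
by elim: w => //= b w ->; rewrite doubleS.
Qed.

(** The padding must outlast the verifier on the longest pair encoding, which has length
    [n.*2.+2 + poly_bound c n]. *)
Lemma time_bound : exists e, forall n,
  poly_bound d (n.*2.+2 + poly_bound c n) < poly_bound e n.
Proof.
apply: (@polyb_bound (fun n => (poly_bound d (n.*2.+2 + poly_bound c n)).+1)).
apply: polyb_succ; apply: (polyb_comp (polyb_poly_bound d)).
apply: polyb_add; last exact: polyb_poly_bound.
do 2!apply: polyb_succ.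
apply: (@polyb_le _ (fun n => 2 * n)) => [n|]; first by lia.
by apply: polyb_mul; [exact: polyb_const | exact: polyb_id].
Qed.

Lemma accepts e w : (forall n, poly_bound d (n.*2.+2 + poly_bound c n) < poly_bound e n) ->
  L w <-> exists t, selects (@opt _ (@unary M) (@win M) (template e w)) t.
Proof.
move=> He; have e_gt0 : 0 < poly_bound e (size w) by apply: leq_ltn_trans (He _).
have p_gt0 : 0 < size (pair_prefix w) by rewrite size_pair_prefix.
rewrite HL selects_tiling ?size_cat ?size_map ?size_pair_prefix //.
rewrite (tableau M (poly_bound c (size w)) p_gt0 e_gt0).
have H y : size y <= poly_bound c (size w) ->
    tm_accept M (cstate (tm_run M (pair_prefix w ++ y) (size (template e w)).-1)) <-> 
    V (pair_enc w y).
  move=> sy; rewrite (_ : pair_enc w y = pair_prefix w ++ y); last by rewrite /pair_prefix -catA.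
  have [n len [hn <-]] := HM (pair_prefix w ++ y).
  rewrite (run_halted hn) //.
  rewrite /template !size_cat size_map !size_nseq size_pair_prefix.
  suff : n < poly_bound e (size w) by lia.
  apply: leq_ltn_trans (leq_trans len _) (He (size w)).
  by apply: leq_poly_bound; rewrite size_cat size_pair_prefix leq_add2l.
by split=> -[y sy h]; exists y => //; apply/H.
Qed.

Variable e : nat.
Hypothesis He : forall n, poly_bound d (n.*2.+2 + poly_bound c n) < poly_bound e n.

Notation K := (c + e).

Lemma reduction n (pc pd : prog tsym K.+4.+1) :
  wf [::] pc -> wf [::] pd ->
  poly_time_computable (fun w =>
    map snd (eval (eval (map tbit w) (stage1 K c e) (@env0 _))
      (stage2 (@unary M) (@win M) n pc pd) (@env0 _))).
Proof.
move=> wc wd; apply: (transducer_poly tbit snd); last exact: wf_stage2.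
by apply: wf_stage1; lia.
Qed.

End Reduction.

Theorem orp_NP_hard : NP_hard ORP_lang.
Proof.
move=> L [V [c [[M [d HM]] HL]]].
have [e He] := time_bound c d; set G : finType := gamma M.
(* One extra dummy makes the decoy exactly as long as the refutation given by a selection. *)
pose pc : prog tsym (c + e).+4.+1 := plit (TG G 1) None true.
pose pd : prog tsym (c + e).+4.+1 := pgoal1 (c + e) G 1.
have wc : wf [::] pc by exact: wf_plit.
have wd : wf [::] pd by exact: wf_goal1.
eexists; first exact: (@reduction c M e 1 pc pd wc wd).
move=> w; cbv beta; rewrite eval_stage1 -/(pair_prefix w) -/(template c e w).
set x := template c e w.
have p1 : prints x enc_lit id pc (@env0 _) (fun l => l \in horn (@nm G 1 x) (Some (HG (goal_index G x) (position x) G (dummy_index G 1 x))) [::]).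
  exact: (@prints_unit _ _ _ x _ None None).
have [F [FE HF]] := @lang_stage2 (c + e) G (@unary M) (@win M) 1 x pc pd (@env0 _) _ _ p1 (@prints_goal1 (c + e) G 1 x (@env0 _)).
rewrite HF (orp_selects (@nm_inj G 1 x) FE (@opt_local _ _ _ x)); first exact: (accepts HM HL w He).
by rewrite card_sum card_sum card_ord; lia.
Qed.

Theorem orp_coNP_hard : coNP_hard ORP_lang.
Proof.
move=> L [V [c [[M [d HM]] HL]]].
have [e He] := time_bound c d; set G : finType := gamma M.
(* Two extra dummies make the decoy one resolution longer; the queried unit is one of them, since
   its name involves no position. *)
pose pc : prog tsym (c + e).+4.+1 := plit (TE G (ord0 : 'I_2)) None true.
pose pd : prog tsym (c + e).+4.+1 := pgoal2 (c + e) G 2.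
have wc : wf [::] pc by exact: wf_plit.
have wd : wf [::] pd by exact: wf_goal2.
eexists; first exact: (@reduction c M e 2 pc pd wc wd).
move=> w; cbv beta; rewrite eval_stage1 -/(pair_prefix w) -/(template c e w).
set x := template c e w.
have p1 : prints x enc_lit id pc (@env0 _) (fun l => l \in horn (@nm G 2 x) (Some (HY (goal_index G x) (position x) G (inr ord0 : dummy_index G 2 x))) [::]).
  exact: (@prints_unit _ _ _ x _ None None).
have [F [FE HF]] := @lang_stage2 (c + e) G (@unary M) (@win M) 2 x pc pd (@env0 _) _ _ p1 (@prints_goal2 (c + e) G 2 x (@env0 _)).
rewrite HF (orp_not_selects (@nm_inj G 2 x) FE (@opt_local _ _ _ x)).
  by rewrite (accepts HM HL w He).
by rewrite card_sum card_sum card_ord; lia.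
Qed.

Theorem theorem9 : NP_hard ORP_lang /\ coNP_hard ORP_lang.
Proof. by split; [exact: orp_NP_hard | exact: orp_coNP_hard]. Qed.
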